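(* Let $\vartheta$ be a primitive and geometrically compatible random substitution on a finite alphabet $\mathcal A$, with geometric hull $(Y_\vartheta,T)$. Then for every $a\in\mathcal A$ the limit \[ h_a^G=\lim_{m\to\infty}\frac{1}{L(\vartheta^m(a))}\log\big(\#\vartheta^m(a)\big) \] exists and $h_a^G=h_{\mathrm{top}}(Y_\vartheta)$.
   Context: $\mathcal A$ is a finite alphabet, $\mathcal A^+$ the set of non-empty finite words over $\mathcal A$; for $w\in\mathcal A^+$, $|w|$ is its length and $|w|_a$ the number of occurrences of the letter $a$ in $w$. $\mathcal A^{\mathbb Z}$ carries the product topology and the left shift $S$. A random substitution is a map $\vartheta$ from $\mathcal A$ to the non-empty finite subsets of $\mathcal A^+$, extended to words by $\vartheta(u_1\cdots u_n)=\{w_1\cdots w_n: w_i\in\vartheta(u_i)\}$ and to sets of words by taking unions; $\vartheta^n$ is the $n$-fold composition. The language $\mathcal L_\vartheta$ is the set of all subwords of words in $\bigcup_{n\ge1,a\in\mathcal A}\vartheta^n(a)$, and $X_\vartheta=\{x\in\mathcal A^{\mathbb Z}: x_i\cdots x_j\in\mathcal L_\vartheta\text{ for all }i\le j\}$. A marginal of $\vartheta$ is a map $\theta:\mathcal A\to\mathcal A^+$ with $\theta(a)\in\vartheta(a)$ for all $a$; its substitution matrix is $M_{ab}=|\theta(b)|_a$. $\vartheta$ is primitive if for some $n\in\mathbb N$ some marginal of $\vartheta^n$ has a primitive substitution matrix. $\vartheta$ is geometrically compatible if there are $\lambda>1$ and a row vector $L\in(0,\infty)^{\mathcal A}$ that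 is a left eigenvector with eigenvalue $\lambda$ of the substitution matrix of every marginal of $\vartheta$; fix such $L$ and write $L(w)=\sum_{a}L_a|w|_a$ (all words in $\vartheta^m(a)$ have the same geometric length, denoted $L(\vartheta^m(a))=\lambda^mL_a$). The geometric hull $(Y_\vartheta,T)$ is the suspension flow over $(X_\vartheta,S)$ with roof function $x\mapsto L_{x_0}$: $Y_\vartheta=\{(x,s):x\in X_\vartheta,\,0\le s\le L_{x_0}\}$ with $(x,L_{x_0})$ identified with $(Sx,0)$, and $T_t(x,s)=(x,s+t)$. *)

(* Defs.v *)
From HB Require Import structures.
From mathcomp Require Import all_boot all_order all_algebra.
From mathcomp Require Import all_classical all_reals.
From mathcomp Require Import ereal topology normedtype sequences exp.
From Stdlib Require Import ClassicalEpsilon.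
Set Implicit Arguments. Unset Strict Implicit. Unset Printing Implicit Defensive.
Import Order.TTheory GRing.Theory Num.Theory numFieldNormedType.Exports.
Local Open Scope classical_set_scope.
Local Open Scope ring_scope.

(* Random substitutions.  A random substitution on the finite alphabet
   A is given by  th : A -> seq (seq A);  the set theta(a) is the set of
   elements of the list  th a  (non-emptiness of the list and of its words
   are hypotheses of the main theorem). *)

Definition subst_word (A : eqType) (th : A -> seq (seq A)) (u : seq A)
  : seq (seq A) :=
  foldr (fun a S => [seq w ++ v | w <- th a, v <- S]) [:: [::]] u.

Definition subst_set (A : eqType) (th : A -> seq (seq A)) (S : seq (seq A))
  : seq (seq A) :=
  undup (flatten (map (subst_word th) S)).

Definition subst_iter (A : eqType) (th : A -> seq (seq A)) (n : nat) (a : A)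
  : seq (seq A) :=
  iter n (subst_set th) [:: [:: a]].

Definition card_subst_iter (A : eqType) (th : A -> seq (seq A)) n a : nat :=
  size (undup (subst_iter th n a)).

Definition is_marginal (A : eqType) (Th : A -> seq (seq A)) (m : A -> seq A) :=
  forall a, m a \in Th a.

Definition subst_mat (A : eqType) (m : A -> seq A) (a b : A) : nat :=
  count_mem a (m b).

Definition mat_mul (A : finType) (M N : A -> A -> nat) (a b : A) : nat :=
  (\sum_(c : A) M a c * N c b)%N.

Definition mat_pow (A : finType) (M : A -> A -> nat) (k : nat) : A -> A -> nat :=
  iter k (mat_mul M) (fun a b => nat_of_bool (a == b)).

Definition primitive_mat (A : finType) (M : A -> A -> nat) :=
  exists k, (0 < k)%N /\ forall a b, (0 < mat_pow M k a b)%N.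

Definition primitive_rs (A : finType) (th : A -> seq (seq A)) :=
  exists n, (1 <= n)%N /\
    exists m : A -> seq A, is_marginal (subst_iter th n) m /\
                           primitive_mat (subst_mat m).

Definition geom_compat_data (R : realType) (A : finType)
  (th : A -> seq (seq A)) (lam : R) (L : A -> R) :=
  1 < lam /\ (forall a, 0 < L a) /\
  forall m : A -> seq A, is_marginal th m ->
    forall b, \sum_(a : A) L a * (subst_mat m a b)%:R = lam * L b.

Definition in_language (A : finType) (th : A -> seq (seq A)) (w : seq A) :=
  exists n a v, (1 <= n)%N /\ v \in subst_iter th n a /\ infix w v.

Definition window (A : Type) (x : int -> A) (i : int) (n : nat) : seq A :=
  [seq x (i + k%:Z) | k <- iota 0 n].

Definition subshift (A : finType) (th : A -> seq (seq A)) : set (int -> A) :=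
  [set x | forall i n, (0 < n)%N -> in_language th (window x i n)].

Definition shift (A : Type) (x : int -> A) : int -> A := fun i => x (i + 1).

(* Geometric hull: the suspension over (X, S) with roof x |-> L(x_0).
   A point of Y is represented by its unique normal form (x, s) with
   x in X and 0 <= s < L(x_0); the identification (x, L(x_0)) ~ (Sx, 0)
   is realised by the quotient map [hull_q] from the closed fundamental
   domain [hull_dom]. *)

Section Hull.
Variables (R : realType) (A : finType) (th : A -> seq (seq A)) (L : A -> R).

Definition hull_pts : set ((int -> A) * R) :=
  [set p | subshift th p.1 /\ 0 <= p.2 /\ p.2 < L (p.1 0)].

Definition hull_dom : set ((int -> A) * R) :=
  [set p | subshift th p.1 /\ 0 <= p.2 /\ p.2 <= L (p.1 0)].

Definition hull_q (p : (int -> A) * R) : (int -> A) * R :=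
  if p.2 < L (p.1 0) then p else (shift p.1, 0).

(* basic neighbourhoods of the product topology on A^Z x R
   (A discrete): cylinders times open intervals *)
Definition near_pt (N : nat) (e : R) (p q : (int -> A) * R) :=
  (forall i : int, `|i| <= N%:Z -> q.1 i = p.1 i) /\ `|q.2 - p.2| < e.

Definition rel_open (D V : set ((int -> A) * R)) :=
  V `<=` D /\
  forall p, V p -> exists N : nat, exists e : R, 0 < e /\
    forall q, D q -> near_pt N e p q -> V q.

Definition hull_open (U : set ((int -> A) * R)) :=
  U `<=` hull_pts /\ rel_open hull_dom (hull_dom `&` hull_q @^-1` U).

(* the suspension flow T_t (t >= 0) on normal forms *)
Definition hull_flow (t : R) (p : (int -> A) * R) : (int -> A) * R :=
  epsilon (inhabits p) (fun q => hull_pts q /\ exists k : nat,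
     q = (iter k (@shift A) p.1, p.2 + t - \sum_(i < k) L (p.1 (i%:Z)))).

End Hull.

(* Topological entropy (Adler--Konheim--McAndrew) of a map f of a
   compact space Y with family of open sets [op]. *)

Section Entropy.
Variables (R : realType) (U : Type).

Definition cover_num (Y : set U) (F : set (set U)) : R :=
  inf [set (size s)%:R | s in [set s : seq (set U) |
         (forall B, B \in s -> F B) /\
         Y `<=` (fun y => exists2 B, B \in s & B y)]].

Definition cover_join (f : U -> U) (C : set (set U)) (n : nat) : set (set U) :=
  [set B | exists g : nat -> set U, (forall k, (k < n)%N -> C (g k)) /\
      B = \bigcap_(k in [set k : nat | (k < n)%N]) (iter k f @^-1` g k)].

Definition open_cover (Y : set U) (op : set (set U)) (C : set (set U)) :=
  C `<=` op /\ Y `<=` \bigcup_(B in C) B.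

Definition entropy_cover (Y : set U) (f : U -> U) (C : set (set U)) : R :=
  limn (fun n => ln (cover_num Y (cover_join f C n.+1)) / n.+1%:R).

Definition top_entropy (Y : set U) (op : set (set U)) (f : U -> U) : \bar R :=
  ereal_sup [set (entropy_cover Y f C)%:E | C in open_cover Y op].

End Entropy.

(* h_top(Y_theta) : entropy of the flow = entropy of its time-one map *)
Definition hull_entropy (R : realType) (A : finType)
  (th : A -> seq (seq A)) (L : A -> R) : \bar R :=
  @top_entropy R _ (hull_pts th L) (hull_open th L) (hull_flow th L 1).

(* Main.v *)
Require Import Defs.
From HB Require Import structures.
From mathcomp Require Import all_boot all_order all_algebra.
From mathcomp Require Import all_classical all_reals.
From mathcomp Require Import ereal topology normedtype sequences exp.
From mathcomp Require Import ring lra zify.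
From Stdlib Require Import ClassicalEpsilon.
Import Order.TTheory GRing.Theory Num.Theory numFieldNormedType.Exports.
Local Open Scope classical_set_scope.
Local Open Scope ring_scope.
Set Implicit Arguments.
Unset Strict Implicit.
Unset Printing Implicit Defensive.

(** Geometric compatibility gives all words of theta^m(u) the same geometric
    length, so concatenations of images split uniquely and log #theta^m is
    additive on words.  Hence the rates r_m(a) = log #theta^m(a) / (lam^m L_a)
    at level m + n dominate averages of the rates at level m: the least rate is
    nondecreasing, and by primitivity it gains a fixed share of the gap to the
    largest rate, so that all rates converge to a common limit h.

    Upper bound: a language word of geometric length T lies, up to two ends of
    bounded length, in theta^m(v) with v of geometric length about T / lam^m, so
    there are at most exp((h + e) T + C) of them.  By a Lebesgue number
    argument, an orbit segment of time n is described, relative to a given open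
    cover, by a word of geometric length n + O(1), the times at which it crosses
    the fibres (polynomially many possibilities, by monotonicity in the
    starting height) and a bounded number of heights.

    Lower bound: for one explicit open cover, points at height 0 whose words
    differ before time n lie in different members of the n-th join; the words
    of theta^m(u) with lam^m L(u) <= n provide exp((h - e) n - C) such points. *)

(** * Iterated images of words *)

Section IteratedImages.
Variables (A : eqType) (th : A -> seq (seq A)).
Implicit Types (u v w : seq A) (m n : nat).

(** Starts from a word, as induction through concatenations requires; at [[:: a]] it is convertible
    to [subst_iter]. *)
Definition iter_word m u : seq (seq A) := iter m (subst_set th) [:: u].

Definition num_images m u : nat := size (undup (iter_word m u)).

Lemma mem_subst_set w (S : seq (seq A)) :
  reflect (exists2 u, u \in S & w \in subst_word th u) (w \in subst_set th S).
Proof.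
rewrite mem_undup; apply: (iffP flattenP) => [[l /mapP[u uS ->] wl]|[u uS wu]].
  by exists u.
by exists (subst_word th u) => //; apply: map_f.
Qed.

Lemma mem_subst_word_cons w a u :
  reflect (exists w1 w2, [/\ w1 \in th a, w2 \in subst_word th u & w = w1 ++ w2])
    (w \in subst_word th (a :: u)).
Proof.
apply: (iffP allpairsP) => [[[w1 w2] /= [h1 h2 ->]]|[w1 [w2 [h1 h2 ->]]]].
  by exists w1, w2.
by exists (w1, w2).
Qed.

Lemma mem_subst_word_cat w u v :
  reflect (exists w1 w2,
      [/\ w1 \in subst_word th u, w2 \in subst_word th v & w = w1 ++ w2])
    (w \in subst_word th (u ++ v)).
Proof.
elim: u w => [|a u IH] w.
  apply: (iffP idP) => [wv|[w1 [w2 []]]]; first by exists [::], w.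
  by rewrite inE => /eqP-> ? ->.
rewrite cat_cons; apply: (iffP (mem_subst_word_cons _ _ _)).
  move=> [w1 [w2 [h1 /IH[w3 [w4 [h3 h4 ->]]] ->]]].
  exists (w1 ++ w3), w4; split=> //; last by rewrite catA.
  by apply/mem_subst_word_cons; exists w1, w3.
move=> [w1 [w2 [/mem_subst_word_cons[w3 [w4 [h3 h4 ->]]] h2 ->]]].
exists w3, (w4 ++ w2); split=> //; last by rewrite catA.
by apply/IH; exists w4, w2.
Qed.

Lemma mem_iter_wordS w m u :
  reflect (exists2 v, v \in iter_word m u & w \in subst_word th v)
    (w \in iter_word m.+1 u).
Proof. exact: mem_subst_set. Qed.

Lemma mem_iter_word0 w u : (w \in iter_word 0 u) = (w == u).
Proof. by rewrite /iter_word inE. Qed.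

Lemma mem_iter_wordD w m n u :
  reflect (exists2 v, v \in iter_word n u & w \in iter_word m v)
    (w \in iter_word (m + n) u).
Proof.
elim: m w => [|m IH] w.
  rewrite add0n; apply: (iffP idP) => [wu|[v vu]].
    by exists w; rewrite // mem_iter_word0.
  by rewrite mem_iter_word0 => /eqP->.
rewrite addSn; apply: (iffP (mem_iter_wordS _ _ _)).
  move=> [v /IH[v' v'u vv'] wv]; exists v' => //.
  by apply/mem_iter_wordS; exists v.
move=> [v vu /mem_iter_wordS[v' v'v wv']]; exists v' => //.
by apply/IH; exists v.
Qed.

Lemma mem_iter_word_cat w m u v :
  reflect (exists w1 w2,
      [/\ w1 \in iter_word m u, w2 \in iter_word m v & w = w1 ++ w2])
    (w \in iter_word m (u ++ v)).
Proof.
elim: m w => [|m IH] w.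
  rewrite mem_iter_word0; apply: (iffP eqP) => [->|[w1 [w2 []]]].
    by exists u, v; rewrite !mem_iter_word0.
  by rewrite !mem_iter_word0 => /eqP-> /eqP->.
apply: (iffP (mem_iter_wordS _ _ _)).
  move=> [z /IH[z1 [z2 [h1 h2 ->]]] /mem_subst_word_cat[w1 [w2 [k1 k2 ->]]]].
  exists w1, w2; split=> //; apply/mem_iter_wordS; first by exists z1.
  by exists z2.
move=> [w1 [w2 [/mem_iter_wordS[z1 h1 k1] /mem_iter_wordS[z2 h2 k2] ->]]].
exists (z1 ++ z2); first by apply/IH; exists z1, z2.
by apply/mem_subst_word_cat; exists w1, w2.
Qed.

Lemma iter_word_nil m w : w \in iter_word m [::] -> w = [::].
Proof.
elim: m w => [|m IH] w; first by rewrite mem_iter_word0 => /eqP.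
by case/mem_iter_wordS => v /IH-> /=; rewrite inE => /eqP.
Qed.

Hypothesis th_neq0 : forall a, th a != [::].

Lemma subst_word_nonempty u : exists w, w \in subst_word th u.
Proof.
elim: u => [|a u [w wu]]; first by exists [::]; rewrite inE.
have [v va] : exists v, v \in th a.
  by case: (th a) (th_neq0 a) => // v s _; exists v; rewrite mem_head.
by exists (v ++ w); apply/mem_subst_word_cons; exists v, w.
Qed.

Lemma iter_word_nonempty m u : exists w, w \in iter_word m u.
Proof.
elim: m => [|m [v vu]]; first by exists u; rewrite mem_iter_word0.
have [w wv] := subst_word_nonempty v.
by exists w; apply/mem_iter_wordS; exists v.
Qed.

Lemma num_images_gt0 m u : (0 < num_images m u)%N.
Proof.
have [w] := iter_word_nonempty m u; rewrite -mem_undup /num_images.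
by case: (undup _).
Qed.

Lemma num_images_le m n u v :
  v \in iter_word n u -> (num_images m v <= num_images (m + n) u)%N.
Proof.
move=> vu; apply: uniq_leq_size; first exact: undup_uniq.
by move=> w; rewrite !mem_undup => wv; apply/mem_iter_wordD; exists v.
Qed.

End IteratedImages.

(** * Geometric length *)

Section GeometricLength.
Variables (R : realType) (A : finType) (L : A -> R).
Hypothesis L_gt0 : forall a, 0 < L a.
Implicit Types (u v w : seq A).

Definition geo_len u : R := \sum_(a <- u) L a.

Lemma geo_len_cat u v : geo_len (u ++ v) = geo_len u + geo_len v.
Proof. exact: big_cat. Qed.

Lemma geo_len_cons a u : geo_len (a :: u) = L a + geo_len u.
Proof. exact: big_cons. Qed.

Lemma geo_len1 a : geo_len [:: a] = L a.
Proof. exact: big_seq1. Qed.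

Lemma geo_len_nil : geo_len [::] = 0.
Proof. exact: big_nil. Qed.

Lemma geo_len_ge0 u : 0 <= geo_len u.
Proof. by apply: sumr_ge0 => a _; apply: ltW. Qed.

Lemma geo_len_eq0 u : geo_len u = 0 -> u = [::].
Proof.
case: u => // a u; rewrite geo_len_cons => e.
by exfalso; have := L_gt0 a; have := geo_len_ge0 u; lra.
Qed.

(** Letters have positive length, so a prefix of a given word is determined by its geometric
    length. *)
Lemma cat_geo_len_inj u u' v v' :
  geo_len u = geo_len u' -> u ++ v = u' ++ v' -> u = u' /\ v = v'.
Proof.
elim: u u' => [|a u IH] [|a' u'] //=.
- by rewrite geo_len_nil => /esym/geo_len_eq0.
- by rewrite geo_len_nil => /geo_len_eq0.
rewrite !geo_len_cons => e [aa]; rewrite -aa in e * => /IH[|-> ->] //.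
exact: addrI e.
Qed.

Definition minL (a0 : A) : R := L [arg min_(a < a0) L a]%O.
Definition maxL (a0 : A) : R := L [arg max_(a > a0) L a]%O.

Variable a0 : A.

Lemma minL_le a : minL a0 <= L a.
Proof. by rewrite /minL; case: arg_minP => // i _; apply. Qed.

Lemma le_maxL a : L a <= maxL a0.
Proof. by rewrite /maxL; case: arg_maxP => // i _; apply. Qed.

Lemma minL_gt0 : 0 < minL a0. Proof. exact: L_gt0. Qed.

Lemma maxL_gt0 : 0 < maxL a0. Proof. exact: L_gt0. Qed.

Lemma size_minL_le u : (size u)%:R * minL a0 <= geo_len u.
Proof.
elim: u => [|a u IH]; first by rewrite mul0r geo_len_nil.
rewrite geo_len_cons /= -natr1 mulrDl mul1r addrC lerD ?minL_le//.
Qed.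

Lemma geo_len_le_maxL u : geo_len u <= (size u)%:R * maxL a0.
Proof.
elim: u => [|a u IH]; first by rewrite mul0r geo_len_nil.
rewrite geo_len_cons /= -natr1 mulrDl mul1r addrC lerD ?le_maxL//.
Qed.

End GeometricLength.

(** * Words of bounded length *)

Section BoundedWords.
Variable A : finType.

Fixpoint words_upto (k : nat) : seq (seq A) :=
  if k is k'.+1 then [::] :: [seq a :: w | a <- enum A, w <- words_upto k']
  else [:: [::]].

Lemma mem_words_upto k w : (size w <= k)%N -> w \in words_upto k.
Proof.
elim: k w => [|k IH] [|a w] //=; rewrite ?mem_head // ltnS => wk.
rewrite inE; apply/orP; right; apply/allpairsP; exists (a, w).
by split=> //=; [rewrite mem_enum|apply: IH].
Qed.

Lemma size_words_upto k : (size (words_upto k) <= #|A|.+1 ^ k)%N.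
Proof.
elim: k => // k IH /=; rewrite size_allpairs -cardE expnS mulSn.
rewrite -add1n leq_add ?expn_gt0//; exact: leq_mul.
Qed.

End BoundedWords.

Lemma size_flatten_map_le (R : realType) (T : eqType) (U : Type)
    (f : T -> seq U) (s : seq T) (M : R) :
  (forall i, i \in s -> (size (f i))%:R <= M) ->
  (size (flatten [seq f i | i <- s]))%:R <= (size s)%:R * M.
Proof.
elim: s => [|i s IH] h; first by rewrite mul0r.
rewrite /= size_cat natrD -natr1 mulrDl mul1r addrC lerD ?h ?mem_head//.
by apply: IH => x xs; apply: h; rewrite inE xs orbT.
Qed.

(** * Growth of the number of images *)

Lemma geo_len_count (R : realType) (A : finType) (L : A -> R) (w : seq A) :
  geo_len L w = \sum_(a : A) L a * (count_mem a w)%:R.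
Proof.
elim: w => [|b w IH].
  by rewrite geo_len_nil big1 // => a _; rewrite mulr0.
rewrite geo_len_cons IH /= (bigD1 b) //= [in RHS](bigD1 b) //= eqxx addrA.
congr (_ + _); first by rewrite add1n -natr1 mulrDr mulr1 addrC.
by apply: eq_bigr => a ab; rewrite eq_sym (negPf ab).
Qed.

(** A positive entry of the power is a chain of letters, each occurring in the marginal image of the
    previous one. The marginal is applied to that letter alone; the letters around it get arbitrary
    images. *)
Lemma mat_pow_gt0_iter_word (A : finType) (th : A -> seq (seq A)) n
    (mg : A -> seq A) k a b :
  (forall a, th a != [::]) ->
  is_marginal (subst_iter th n) mg -> (0 < mat_pow (subst_mat mg) k a b)%N ->
  exists2 v, v \in iter_word th (k * n) [:: b] & a \in v.
Proof.
move=> th_neq0 mgP; elim: k a => [|k IH] a.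
  rewrite /mat_pow /=; case: eqP => // <- _; exists [:: a].
    by rewrite mem_iter_word0.
  by rewrite mem_head.
rewrite {1}/mat_pow iterS -/(mat_pow _ _) /mat_mul lt0n sum_nat_eq0.
rewrite negb_forall => /existsP[c]; rewrite /= muln_eq0 negb_or -!lt0n.
move=> /andP[ac /IH[v vb cv]].
have {}ac : a \in mg c by rewrite -has_pred1 has_count.
case/splitPr: cv vb => v1 v2 vb.
have [p p1] := iter_word_nonempty th_neq0 n v1.
have [q q2] := iter_word_nonempty th_neq0 n v2.
exists (p ++ mg c ++ q); last by rewrite !mem_cat ac orbT.
rewrite mulSn; apply/mem_iter_wordD; exists (v1 ++ c :: v2) => //.
apply/mem_iter_word_cat; exists p, (mg c ++ q); split=> //.
rewrite -cat1s; apply/mem_iter_word_cat; exists (mg c), q; split=> //.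
Qed.

Section CompatibleSubstitution.
Variables (R : realType) (A : finType) (th : A -> seq (seq A)).
Variables (lam : R) (L : A -> R).
Hypothesis th_neq0 : forall a, th a != [::].
Hypothesis gc : geom_compat_data th lam L.
Implicit Types (u v w : seq A) (m n : nat).

Let lam_gt1 : 1 < lam. Proof. by case: gc. Qed.
Let L_gt0 a : 0 < L a. Proof. by case: gc => _ []. Qed.
Let lam_gt0 : 0 < lam. Proof. exact: lt_trans lam_gt1. Qed.

(** Compatibility speaks of whole marginals, so [w] is completed to one by arbitrary images of the
    other letters. *)
Lemma geo_len_image b w : w \in th b -> geo_len L w = lam * L b.
Proof.
move=> wb; case: gc => _ [_ /(_ (fun a => if a == b then w else head [::] (th a)))].
rewrite geo_len_count => <-; last first.
  move=> a; case: eqP => [->//|_].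
  by case: (th a) (th_neq0 a) => // v s _; rewrite mem_head.
by apply: eq_bigr => a _; rewrite /subst_mat eqxx.
Qed.

Lemma geo_len_subst_word u w :
  w \in subst_word th u -> geo_len L w = lam * geo_len L u.
Proof.
elim: u w => [|a u IH] w.
  by rewrite inE => /eqP->; rewrite geo_len_nil mulr0.
case/mem_subst_word_cons => w1 [w2 [/geo_len_image h1 /IH h2 ->]].
by rewrite geo_len_cat h1 h2 geo_len_cons mulrDr.
Qed.

Lemma geo_len_iter_word m u w :
  w \in iter_word th m u -> geo_len L w = lam ^+ m * geo_len L u.
Proof.
elim: m w => [|m IH] w.
  by rewrite mem_iter_word0 => /eqP->; rewrite expr0 mul1r.
case/mem_iter_wordS => v /IH h /geo_len_subst_word->.
by rewrite h exprS mulrA.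
Qed.

Lemma iter_word_neq0 m u w : u != [::] -> w \in iter_word th m u -> w != [::].
Proof.
move=> un /geo_len_iter_word e; apply/eqP => w0; move: e.
rewrite w0 geo_len_nil => /esym/eqP; rewrite mulf_eq0 expf_eq0.
rewrite (gt_eqF lam_gt0) andbF /= => /eqP/(geo_len_eq0 L_gt0).
exact/eqP.
Qed.

(* All words of [iter_word th m u] have the same geometric length, so a
   concatenation of two images splits in only one way. *)
Lemma num_images_cat m u v :
  num_images th m (u ++ v) = (num_images th m u * num_images th m v)%N.
Proof.
rewrite /num_images -(size_allpairs (fun x y => x ++ y)).
apply/perm_size/uniq_perm; first exact: undup_uniq.
  apply: allpairs_uniq; try exact: undup_uniq.
  move=> [x y] [x' y'] /allpairsP[[? ?] /= [hx _ [-> ->]]].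
  move=> /allpairsP[[? ?] /= [hx' _ [-> ->]]].
  rewrite !mem_undup in hx hx'.
  case/(cat_geo_len_inj L_gt0) => [|-> ->//].
  by rewrite (geo_len_iter_word hx) (geo_len_iter_word hx').
move=> w; rewrite mem_undup; apply/mem_iter_word_cat/allpairsP.
  by move=> [w1 [w2 [h1 h2 ->]]]; exists (w1, w2); rewrite !mem_undup.
move=> [[w1 w2] /=]; rewrite !mem_undup => -[h1 h2 ->].
by exists w1, w2.
Qed.

Lemma num_imagesR_gt0 m u : 0 < (num_images th m u)%:R :> R.
Proof. by rewrite ltr0n num_images_gt0. Qed.

Lemma num_images_nil m : num_images th m [::] = 1%N.
Proof.
have := num_images_cat m [::] [::]; have := num_images_gt0 th_neq0 m [::].
rewrite /=; nia.
Qed.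

Lemma ln_num_images m u :
  ln (num_images th m u)%:R = \sum_(a <- u) ln (num_images th m [:: a])%:R :> R.
Proof.
elim: u => [|a u IH]; first by rewrite num_images_nil ln1 big_nil.
rewrite -cat1s num_images_cat natrM lnM ?posrE ?num_imagesR_gt0//.
by rewrite IH big_cons.
Qed.

Definition image_rate m a : R :=
  ln (num_images th m [:: a])%:R / (lam ^+ m * L a).

Lemma scale_gt0 m a : 0 < lam ^+ m * L a.
Proof. by rewrite mulr_gt0 ?exprn_gt0. Qed.

Lemma ln_num_images1 m a :
  ln (num_images th m [:: a])%:R = image_rate m a * (lam ^+ m * L a).
Proof. by rewrite /image_rate divfK ?gt_eqF ?scale_gt0. Qed.

Lemma image_rate_ge0 m a : 0 <= image_rate m a.
Proof.
by apply: divr_ge0; [rewrite ln_ge0 ?ler1n ?num_images_gt0|apply/ltW/scale_gt0].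
Qed.

Variable a0 : A.

Definition min_rate m : R := image_rate m [arg min_(a < a0) image_rate m a]%O.
Definition max_rate m : R := image_rate m [arg max_(a > a0) image_rate m a]%O.

Lemma min_rate_le m a : min_rate m <= image_rate m a.
Proof. by rewrite /min_rate; case: arg_minP => // i _; apply. Qed.

Lemma le_max_rate m a : image_rate m a <= max_rate m.
Proof. by rewrite /max_rate; case: arg_maxP => // i _; apply. Qed.

Lemma min_rate_ge0 m : 0 <= min_rate m. Proof. exact: image_rate_ge0. Qed.
Lemma max_rate_ge0 m : 0 <= max_rate m. Proof. exact: image_rate_ge0. Qed.

(** The logarithm and the geometric length are both additive over letters, so the rate of a word is
    the average of the rates of its letters, weighted by geometric length. *)
Lemma ln_num_images_ge m u :
  min_rate m * (lam ^+ m * geo_len L u) <= ln (num_images th m u)%:R.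
Proof.
rewrite ln_num_images /geo_len !mulr_sumr ler_sum // => a _.
by rewrite ln_num_images1 ler_pM2r ?scale_gt0 ?min_rate_le.
Qed.

Lemma ln_num_images_le m u :
  ln (num_images th m u)%:R <= max_rate m * (lam ^+ m * geo_len L u).
Proof.
rewrite ln_num_images /geo_len !mulr_sumr ler_sum // => a _.
by rewrite ln_num_images1 ler_pM2r ?scale_gt0 ?le_max_rate.
Qed.

Lemma ln_num_images_mono m n u v : v \in iter_word th n u ->
  ln (num_images th m v)%:R <= ln (num_images th (m + n) u)%:R :> R.
Proof.
move=> vu; rewrite ler_ln ?posrE ?num_imagesR_gt0// ler_nat.
exact: num_images_le vu.
Qed.

Lemma min_rate_nondecreasing : {homo min_rate : m n / (m <= n)%N >-> m <= n}.
Proof.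
move=> m n mn; rewrite -(subnKC mn) {2}/min_rate; set a := [arg min_(_ < _) _]%O.
(* Only the images of [a] that pass through one fixed [v] are counted; their rate is already an
   average of rates at level [m]. *)
have [v va] := iter_word_nonempty th_neq0 (n - m) [:: a].
have := le_trans (ln_num_images_ge m v) (ln_num_images_mono m va).
rewrite (geo_len_iter_word va) geo_len1 ln_num_images1.
by rewrite [_ ^+ m * _]mulrA -exprD ler_pM2r ?scale_gt0.
Qed.

(** Exponential rate, per unit of geometric length, of a crude bound on the number of all words:
    there are at most (#|A| + 1)^k words of at most k letters. *)
Definition kappa : R := ln #|A|.+1%:R / minL L a0.

Definition short_words (T : R) : seq (seq A) :=
  [seq w <- words_upto A (Num.truncn (T / minL L a0)) | geo_len L w <= T].

Lemma mem_short_words T w : geo_len L w <= T -> w \in short_words T.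
Proof.
move=> wT; rewrite mem_filter wT mem_words_upto // -ltnS.
rewrite -(ltr_nat R); apply: le_lt_trans (truncnS_gt _).
by rewrite ler_pdivlMr ?minL_gt0// (le_trans (size_minL_le _ _ _)).
Qed.

Lemma short_words_len T w : w \in short_words T -> geo_len L w <= T.
Proof. by rewrite mem_filter => /andP[]. Qed.

Lemma size_short_words T : 0 <= T -> (size (short_words T))%:R <= expR (kappa * T).
Proof.
move=> T0; set k := Num.truncn (T / minL L a0).
have h : (size (short_words T) <= #|A|.+1 ^ k)%N.
  rewrite size_filter; apply: leq_trans (count_size _ _) _.
  exact: size_words_upto.
apply: (@le_trans _ _ ((#|A|.+1 ^ k)%N%:R)); first by rewrite ler_nat.
rewrite natrX -[X in X <= _]lnK ?posrE ?exprn_gt0// ler_expR lnXn//.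
rewrite -[ln _ *+ k]mulr_natr /kappa -mulrA ler_wpM2l ?ln_ge0 ?ler1n//.
by rewrite mulrC truncn_le // mulr_ge0 // ltW // invr_gt0 minL_gt0.
Qed.

Lemma image_rate_le_kappa m a : image_rate m a <= kappa.
Proof.
rewrite ler_pdivrMr ?scale_gt0// -ler_expR lnK ?posrE ?num_imagesR_gt0//.
apply: le_trans (size_short_words (ltW (scale_gt0 m a))).
rewrite ler_nat; apply: uniq_leq_size; first exact: undup_uniq.
move=> w; rewrite mem_undup => /geo_len_iter_word e.
by apply: mem_short_words; rewrite e geo_len1.
Qed.

Lemma min_rate_is_cvg : cvgn min_rate.
Proof.
apply: nondecreasing_is_cvgn; first exact: min_rate_nondecreasing.
by exists kappa => _ [m _ <-]; apply: image_rate_le_kappa.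
Qed.

Definition geo_entropy : R := limn min_rate.

Lemma min_rate_le_entropy m : min_rate m <= geo_entropy.
Proof. exact: nondecreasing_cvgn_le min_rate_nondecreasing min_rate_is_cvg m. Qed.

Lemma geo_entropy_ge0 : 0 <= geo_entropy.
Proof. exact: le_trans (min_rate_ge0 0) (min_rate_le_entropy 0). Qed.

Hypothesis prim : primitive_rs th.

Lemma primitive_letters :
  exists2 J, (0 < J)%N &
    forall a b, exists2 v, v \in iter_word th J [:: b] & a \in v.
Proof.
case: prim => n [n0 [mg [mgP [k [k0 kP]]]]].
exists (k * n)%N; [by rewrite muln_gt0 k0 | move=> a b].
exact: mat_pow_gt0_iter_word (kP a b).
Qed.

(* An image of the worst letter contains the best one, so the minimal rate picks
   up a fixed proportion of the gap between the two. *)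
Lemma min_rate_gap : exists J, exists2 d : R, 0 < d &
  forall m, d * (max_rate m - min_rate m) <= min_rate (m + J) - min_rate m.
Proof.
have [J _ JP] := primitive_letters; exists J.
(* Lower bound for L b / (lam^J L a), the share of one letter [b] in the geometric length of an
   image of [a]. *)
exists (minL L a0 / (lam ^+ J * maxL L a0)).
  by rewrite divr_gt0 ?minL_gt0 // mulr_gt0 ?exprn_gt0 ?maxL_gt0.
move=> m; rewrite {2}/min_rate; set a := [arg min_(_ < _) _]%O.
rewrite {1}/max_rate; set b := [arg max_(_ > _) _]%O.
have [v va bv] := JP b a.
have := ln_num_images_mono m va; rewrite ln_num_images1.
have lv := geo_len_iter_word va; rewrite geo_len1 in lv.
case/splitPr: bv va lv => v1 v2 _ lv.
rewrite -cat1s !num_images_cat !natrM !lnM ?posrE ?mulr_gt0 ?num_imagesR_gt0//.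
have := ln_num_images_ge m v1; have := ln_num_images_ge m v2.
rewrite ln_num_images1 exprD -mulrA -lv geo_len_cat geo_len_cons.
set r := image_rate (m + J) _; set t := image_rate m b => h2 h1 h3.
have lm : 0 < lam ^+ m by rewrite exprn_gt0.
have tr : 0 <= t - min_rate m by rewrite subr_ge0 min_rate_le.
have lJ : 0 < lam ^+ J by rewrite exprn_gt0.
(* Since [v1] and [v2] count at least at the minimal rate, the gain over that rate is at least the
   contribution of [b]. *)
have hL : (t - min_rate m) * L b <= (r - min_rate m) * (lam ^+ J * L a).
  rewrite -lv geo_len_cat geo_len_cons -(ler_pM2l lm); nra.
have rl : 0 <= r - min_rate m.
  rewrite -(pmulr_lge0 _ (mulr_gt0 lJ (L_gt0 a))).
  by apply: le_trans hL; rewrite mulr_ge0 // ltW.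
rewrite mulrAC ler_pdivrMr ?mulr_gt0 ?maxL_gt0//.
rewrite mulrC; apply: (le_trans (ler_wpM2l tr (minL_le _ _ b))).
apply: (le_trans hL); rewrite ler_wpM2l // ler_wpM2l ?le_maxL//; exact: ltW.
Qed.

(** By [min_rate_gap] the distance between the two extreme rates is at most a constant times an
    increment of [min_rate], and the increments of a convergent sequence tend to 0. *)
Lemma max_rate_cvg : max_rate n @[n --> \oo] --> geo_entropy.
Proof.
have [J [d d0 dP]] := min_rate_gap.
have cJ : min_rate (n + J)%N @[n --> \oo] --> geo_entropy.
  by rewrite cvg_shiftn; exact: min_rate_is_cvg.
apply: (@squeeze_cvgr _ _ _ _ min_rate
  (fun n => min_rate n + d^-1 * (min_rate (n + J)%N - min_rate n))).
- near=> n; rewrite min_rate_le /= -lerBlDl ler_pdivlMl //; exact: dP.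
- exact: min_rate_is_cvg.
rewrite -[X in _ --> X]addr0 -[X in _ + X](mulr0 d^-1) -[X in _ * X](subrr geo_entropy).
apply: cvgD; first exact: min_rate_is_cvg.
by apply: cvgMr; apply: cvgB => //; exact: min_rate_is_cvg.
Unshelve. all: by end_near. Qed.

Lemma image_rate_cvg a : image_rate n a @[n --> \oo] --> geo_entropy.
Proof.
apply: (@squeeze_cvgr _ _ _ _ min_rate max_rate);
  [|exact: min_rate_is_cvg|exact: max_rate_cvg].
by near=> n; rewrite min_rate_le le_max_rate.
Unshelve. all: by end_near. Qed.

(** * The language *)

Lemma in_language_infix w v : infix w v -> in_language th v -> in_language th w.
Proof.
move=> wv [n [a [z [n0 [za vz]]]]]; exists n, a, z; split=> //; split=> //.
exact: infix_trans vz.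
Qed.

Lemma iter_word_around k n a b v1 v2 w :
  v1 ++ a :: v2 \in iter_word th k [:: b] -> w \in iter_word th n [:: a] ->
  exists p q, [/\ p \in iter_word th n v1, q \in iter_word th n v2 &
    p ++ w ++ q \in iter_word th (n + k) [:: b]].
Proof.
move=> vb wa.
have [p p1] := iter_word_nonempty th_neq0 n v1.
have [q q2] := iter_word_nonempty th_neq0 n v2.
exists p, q; split=> //; apply/mem_iter_wordD; exists (v1 ++ a :: v2) => //.
apply/mem_iter_word_cat; exists p, (w ++ q); split=> //.
by rewrite -cat1s; apply/mem_iter_word_cat; exists w, q.
Qed.

(** A letter that occurs in its own images at high levels lets [in_language_level] place a language
    word of low level inside an image of level at least [m]. *)
Lemma letter_recurs i : exists2 k, (i <= k)%N &
  forall a, exists2 v, v \in iter_word th k [:: a] & a \in v.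
Proof.
have [J J0 JP] := primitive_letters.
exists (i * J)%N; first exact: leq_pmulr.
elim: i => [|i IH] a.
  by exists [:: a]; rewrite ?mem_iter_word0 ?mem_head.
have [v va av] := IH a; have [w wa aw] := JP a a.
case/splitPr: av va => v1 v2 va.
have [p [q [_ _ h]]] := iter_word_around va wa.
by exists (p ++ w ++ q); rewrite ?mulSn // !mem_cat aw orbT.
Qed.

Lemma in_language_level m w : in_language th w ->
  exists n a v, v \in iter_word th (m + n) [:: a] /\ infix w v.
Proof.
move=> [n [a [v [_ [va wv]]]]]; have [k mk /(_ a)[z za az]] := letter_recurs m.
case/splitPr: az za => z1 z2 za.
have [p [q [_ _ h]]] := iter_word_around za va.
exists (n + k - m)%N, a, (p ++ v ++ q); rewrite subnKC; last first.
  exact: leq_trans (leq_addl _ _).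
split=> //; apply: infix_trans wv _; exact: infix_infix.
Qed.

Lemma expr_lam_unbounded (x : R) : exists2 k, (0 < k)%N & x < lam ^+ k.
Proof.
have l1 : 0 < lam - 1 by rewrite subr_gt0.
exists (Num.truncn (x / (lam - 1))).+1 => //; set k := _.+1.
have : x < k%:R * (lam - 1) by rewrite -ltr_pdivrMr // truncnS_gt.
(* Bernoulli's inequality. *)
have : forall j, 1 + j%:R * (lam - 1) <= lam ^+ j.
  elim=> [|j IH]; first by rewrite expr0 mul0r addr0.
  have j0 : 0 <= j%:R :> R by [].
  rewrite exprS -natr1; move: IH; set y := j%:R in j0 *; set z := lam ^+ j.
  move=> IH; have : lam * (1 + y * (lam - 1)) <= lam * z by rewrite ler_pM2l.
  have := mulr_ge0 j0 (sqr_ge0 (lam - 1)).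
  by nra.
by move=> /(_ k); lra.
Qed.

Lemma long_iter_word (x : R) a :
  exists2 k, (0 < k)%N &
    forall v, v \in iter_word th k [:: a] -> x < geo_len L v.
Proof.
have [k k0 kP] := expr_lam_unbounded (x / L a).
exists k => // v /geo_len_iter_word->.
by rewrite geo_len1 -ltr_pdivrMr.
Qed.

(** An image of [a] longer than twice [maxL] has at least three letters; expanding the second one
    until [a] occurs leaves non-empty images of the others on both sides. *)
Lemma interior_letter a : exists k v1 v2,
  [/\ v1 != [::], v2 != [::] & v1 ++ a :: v2 \in iter_word th k [:: a]].
Proof.
have [J J0 JP] := primitive_letters.
have [k _ kP] := long_iter_word (2 * maxL L a0) a.
have [v va] := iter_word_nonempty th_neq0 k [:: a].
have sv : (2 < size v)%N.
  rewrite -(ltr_nat R) -(ltr_pM2r (maxL_gt0 L_gt0 a0)).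
  exact: lt_le_trans (kP _ va) (geo_len_le_maxL _ _ _).
case: v va sv => [|c1 [|c2 [|c3 v]]] //= va _.
have [w wc aw] := JP a c2.
have [p [q [hp hq hw]]] := iter_word_around (v1 := [:: c1]) va wc.
case/splitPr: aw hw => w1 w2 hw; exists (J + k)%N, (p ++ w1), (w2 ++ q).
have pn : p != [::] by apply: iter_word_neq0 hp.
have qn : q != [::] by apply: iter_word_neq0 hq.
split; first by case: (p) pn.
  by case: (w2).
by move: hw; rewrite -!catA.
Qed.

Lemma in_language_extend w : in_language th w ->
  exists cd : A * A, in_language th (cd.1 :: rcons w cd.2).
Proof.
move=> [n [a [v [n0 [va /infixP[x [y vE]]]]]]].
have [k [v1 [v2 [h1 h2 hv]]]] := interior_letter a.
have [p [q [hp hq hpq]]] := iter_word_around hv va.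
have px : p ++ x != [::] by case: (p) (iter_word_neq0 h1 hp).
have yq : y ++ q != [::] by case: (y) (iter_word_neq0 h2 hq).
move: hpq; rewrite vE -!catA (catA p x).
case/lastP: (p ++ x) px => // p' c _; case: (y ++ q) yq => // d q' _ h.
exists (c, d), (n + k)%N, a; eexists; split; last first.
  split; first exact: h.
  by apply/infixP; exists p', q'; rewrite !cat_rcons /= ?cat_rcons.
exact: leq_trans (leq_addr _ _).
Qed.

(** One letter is added on each side per step, so [w] starts at index [k] of [grow ext w k]. *)
Fixpoint grow (ext : seq A -> A * A) w k : seq A :=
  if k is k'.+1 then
    (ext (grow ext w k')).1 :: rcons (grow ext w k') (ext (grow ext w k')).2
  else w.

Lemma size_grow ext w k : size (grow ext w k) = (size w + k.*2)%N.
Proof. by elim: k => [|k IH] /=; rewrite ?addn0 // size_rcons IH doubleS !addnS. Qed.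

Lemma nth_grow ext w k j i : (i < size (grow ext w k))%N ->
  nth a0 (grow ext w (k + j)) (i + j) = nth a0 (grow ext w k) i.
Proof.
move=> ik; elim: j => [|j IH]; first by rewrite !addn0.
rewrite !addnS /= nth_rcons ifT // size_grow.
by move: ik; rewrite size_grow; lia.
Qed.

(** Extending forever on both sides yields nested language words; they define a point each of whose
    windows lies in one of them. *)
Lemma in_language_window w : in_language th w ->
  exists2 x, subshift th x & window x 0 (size w) = w.
Proof.
wlog wn : w / w != [::] => [IH|].
  have [->|wn] := eqVneq w [::]; last exact: IH.
  by move=> /in_language_extend[cd /IH[//|x xX _]]; exists x.
move=> wl.
have /boolp.choice[ext extP] : forall v, exists cd : A * A,
    in_language th v -> in_language th (cd.1 :: rcons v cd.2).
  move=> v.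
  have [/in_language_extend[cd h]|nv] := pselect (in_language th v).
    by exists cd.
  by exists (a0, a0).
have gl k : in_language th (grow ext w k) by elim: k => //= k; exact: extP.
have sw : (0 < size w)%N by rewrite lt0n size_eq0.
(* Coordinate [i] is read at index |i| + i of stage |i|, which contains it; [xE] shows that later
   stages agree. *)
pose x (i : int) : A := nth a0 (grow ext w `|i|%N) (`|(`|i|%N%:Z + i)%R|%N).
have xE K (i : int) j : `|i| <= K%:Z -> K%:Z + i = j%:Z ->
    x i = nth a0 (grow ext w K) j.
  move=> iK ij; rewrite /x; set k := `|i|%N; set l := `|(_ + _)%R|%N.
  have kK : (k <= K)%N by rewrite /k; lia.
  rewrite -(subnKC kK) -(nth_grow (K - k)); last first.
    by rewrite size_grow /l /k; lia.
  by congr nth; rewrite /l /k; lia.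
have wE (i : int) n K (j : nat) : (forall k, (k < n)%N -> `|i + k%:Z| <= K%:Z) ->
    K%:Z + i = j%:Z -> (j + n <= size (grow ext w K))%N ->
    window x i n = take n (drop j (grow ext w K)).
  move=> iK ij jn; apply: (@eq_from_nth _ a0).
    by rewrite size_map size_iota size_takel // size_drop; lia.
  move=> k; rewrite size_map size_iota => kn.
  rewrite (nth_map 0%N) ?size_iota// nth_iota // add0n nth_take // nth_drop.
  by apply: xE; [exact: iK|lia].
exists x.
  move=> i n n0; pose K := (`|i| + n)%N.
  have [j jE] : exists j : nat, K%:Z + i = j%:Z by exists `|(K%:Z + i)%R|%N; lia.
  rewrite (wE _ _ K j) //; [|by move=> k kn; lia|by rewrite size_grow; lia].
  apply: in_language_infix (gl K).
  apply: infix_trans (infix_drop _ j); exact: infix_take.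
rewrite (wE _ _ (size w) (size w)) //; first last.
- by rewrite size_grow; lia.
- by lia.
- by move=> k kn; lia.
apply: (@eq_from_nth _ a0).
  by rewrite size_takel // size_drop size_grow; lia.
move=> k; rewrite size_takel ?size_drop ?size_grow; last by lia.
move=> kn; rewrite nth_take // nth_drop addnC.
by rewrite -[X in grow _ _ X]add0n nth_grow.
Qed.

(** * Counting the language *)

(** Letters of [v0] whose images lie entirely within [p] are dropped; what remains of [p] is part of
    the image of one letter. *)
Lemma trim_left m v0 p w : p ++ w \in iter_word th m v0 ->
  exists v p', p' ++ w \in iter_word th m v /\ geo_len L p' <= lam ^+ m * maxL L a0.
Proof.
elim: v0 p => [|b v0 IH] p.
  move=> h; exists [::], p; split=> //; move/iter_word_nil: h.
  case: p => // _; rewrite geo_len_nil ltW // mulr_gt0 ?exprn_gt0 ?maxL_gt0//.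
rewrite -cat1s => h; have /mem_iter_word_cat[z1 [z2 [h1 h2 e]]] := h.
have [zp|pz] := leqP (size z1) (size p).
  apply: (IH (drop (size z1) p)).
  have := congr1 (drop (size z1)) e; rewrite [RHS]drop_size_cat // drop_cat.
  case: ltnP => [_ ->//|pz ze]; rewrite drop_oversize // cat0s.
  by move: ze; rewrite (_ : size z1 - size p = 0)%N ?drop0 => [->//|]; lia.
exists ([:: b] ++ v0), p; split=> //.
apply: (@le_trans _ _ (geo_len L z1)); last first.
  by rewrite (geo_len_iter_word h1) geo_len1 ler_pM2l ?exprn_gt0 ?le_maxL.
have := congr1 (take (size p)) e; rewrite [LHS]take_size_cat // take_cat pz => ->.
by rewrite -[X in _ <= geo_len _ X](cat_take_drop (size p)) geo_len_cat lerDl geo_len_ge0.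
Qed.

Lemma trim_right m v0 w q : w ++ q \in iter_word th m v0 ->
  exists v q', w ++ q' \in iter_word th m v /\ geo_len L q' <= lam ^+ m * maxL L a0.
Proof.
elim/last_ind: v0 q => [|v0 b IH] q.
  move=> h; exists [::], q; split=> //; move/iter_word_nil: h.
  case: w => //= ->; rewrite geo_len_nil ltW // mulr_gt0 ?exprn_gt0 ?maxL_gt0//.
rewrite -cats1 => h; have /mem_iter_word_cat[z1 [z2 [h1 h2 e]]] := h.
have [wz|zw] := leqP (size w) (size z1).
  apply: (IH (drop (size w) z1)); suff -> : w ++ drop (size w) z1 = z1 by [].
  rewrite -[RHS](cat_take_drop (size w)); congr (_ ++ _).
  have := congr1 (take (size w)) e; rewrite [LHS]take_size_cat // take_cat.
  case: ltnP => // ?; rewrite (_ : size w - size z1 = 0)%N; last by lia.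
  by rewrite take0 cats0 take_oversize.
exists (v0 ++ [:: b]), q; split=> //.
apply: (@le_trans _ _ (geo_len L z2)); last first.
  by rewrite (geo_len_iter_word h2) geo_len1 ler_pM2l ?exprn_gt0 ?le_maxL.
have := congr1 (drop (size z1)) e; rewrite [RHS]drop_size_cat // drop_cat zw => <-.
by rewrite geo_len_cat lerDr geo_len_ge0.
Qed.

(* A long language word sits, up to two short ends, in an image of level [m] of a
   word shorter by the factor [lam ^+ m]; the latter is counted by [kappa] only. *)
Lemma language_count_level m : exists C : R, forall T, 0 <= T ->
  exists2 S : seq (seq A),
    (forall w, in_language th w -> geo_len L w <= T -> w \in S) &
    (size S)%:R <= expR (T * (max_rate m + kappa / lam ^+ m) + C).
Proof.
have lm : 0 < lam ^+ m by rewrite exprn_gt0.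
have Lx := maxL_gt0 L_gt0 a0; have Ln := minL_gt0 L_gt0 a0.
(* [c] exceeds the number of letters of either trimmed end. *)
have [c cS cP] : exists2 c, (0 < c)%N & lam ^+ m * maxL L a0 / minL L a0 < c%:R.
  by exists (Num.truncn (lam ^+ m * maxL L a0 / minL L a0)).+1 => //; exact: truncnS_gt.
exists (2 * maxL L a0 * (kappa + max_rate m * lam ^+ m) + 2 * ln c%:R) => T T0.
(* An image made of the word and its two ends has geometric length at most T + 2 lam^m maxL;
   dividing by lam^m bounds its preimage. *)
pose X := T / lam ^+ m + 2 * maxL L a0.
have X0 : 0 <= X.
  by apply: addr_ge0; [apply: divr_ge0 => //|apply: mulr_ge0 => //]; apply: ltW.
pose Z := flatten [seq undup (iter_word th m v) | v <- short_words X].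
(* The word is recovered from the image and the sizes of the two ends. *)
exists [seq drop ij.1 (take (size z - ij.2) z) | z <- Z,
         ij <- [seq (i, j) | i <- iota 0 c, j <- iota 0 c]].
  move=> w wl wT; have [n [a [z [za /infixP[p0 [q0 zE]]]]]] := in_language_level m wl.
  have /mem_iter_wordD[v0 _ zv0] := za; rewrite zE in zv0.
  have [v1 [p [h1 pl]]] := trim_left zv0; rewrite catA in h1.
  have [v [q [h ql]]] := trim_right h1.
  have short s : geo_len L s <= lam ^+ m * maxL L a0 -> size s \in iota 0 c.
    move=> sl; rewrite mem_iota add0n /= -(ltr_nat R).
    apply: le_lt_trans cP.
    by rewrite ler_pdivlMr // (le_trans (size_minL_le _ _ _)).
  apply/allpairsP; exists ((p ++ w) ++ q, (size p, size q)) => /=; split.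
  - apply/flattenP; exists (undup (iter_word th m v)); last by rewrite mem_undup.
    apply/mapP; exists v => //; apply: mem_short_words.
    have := geo_len_iter_word h; rewrite !geo_len_cat => e.
    rewrite -(ler_pM2l lm) -e /X mulrDr mulrCA divff ?gt_eqF // mulr1.
    by lra.
  - by apply/allpairsP; exists (size p, size q); split=> //=; apply: short.
  - by rewrite size_cat addnK take_size_cat // drop_size_cat.
rewrite !size_allpairs !size_iota !natrM.
have c0 : 0 < c%:R :> R by rewrite ltr0n.
have hZ : (size Z)%:R <= expR (kappa * X) * expR (max_rate m * (lam ^+ m * X)).
  apply: le_trans (_ : _ <= (size (short_words X))%:R *
    expR (max_rate m * (lam ^+ m * X))) _.
    apply: size_flatten_map_le => v /short_words_len vX.
    rewrite -[X in X <= _]lnK ?posrE ?num_imagesR_gt0// ler_expR.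
    apply: le_trans (ln_num_images_le m v) _.
    by rewrite ler_wpM2l ?max_rate_ge0 // ler_pM2l.
  by rewrite ler_wpM2r ?expR_ge0 ?size_short_words.
apply: (@le_trans _ _ (expR (kappa * X) *
  expR (max_rate m * (lam ^+ m * X)) * (c%:R * c%:R))).
  by rewrite ler_wpM2r // mulr_ge0 // ltW.
rewrite -[c%:R]lnK ?posrE // -!expRD ler_expR lnK ?posrE//.
rewrite le_eqVlt; apply/orP; left; apply/eqP.
rewrite /X; field; exact: lt0r_neq0.
Qed.

Lemma language_count (e : R) : 0 < e -> exists C : R, forall T, 0 <= T ->
  exists2 S : seq (seq A),
    (forall w, in_language th w -> geo_len L w <= T -> w \in S) &
    (size S)%:R <= expR (T * (geo_entropy + e) + C).
Proof.
move=> e0.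
have h : max_rate n + kappa * (lam^-1) ^+ n @[n --> \oo] --> geo_entropy.
  rewrite -[X in _ --> X]addr0 -[X in _ + X](mulr0 kappa).
  apply: cvgD; first exact: max_rate_cvg.
  apply: cvgMr; apply: cvg_expr; rewrite ger0_norm ?invr_ge0 ?ltW//.
  by rewrite invf_lt1.
have [m _ /(_ m (leqnn m)) hm] : \forall n \near \oo,
    max_rate n + kappa * (lam^-1) ^+ n < geo_entropy + e.
  by apply: (cvgr_lt geo_entropy h); rewrite ltrDl.
have [C CP] := language_count_level m; exists C => T T0.
have [S SP Ss] := CP T T0; exists S => //; apply: le_trans Ss _.
by rewrite ler_expR lerD2r ler_wpM2l // -exprVn ltW.
Qed.

Lemma geo_len_prefix z (x : R) : 0 <= x -> x < geo_len L z ->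
  exists u v, [/\ z = u ++ v, geo_len L u <= x & x < geo_len L u + maxL L a0].
Proof.
elim: z x => [|b z IH] x x0; first by rewrite geo_len_nil; lra.
rewrite geo_len_cons => xz; have [bx|xb] := leP (L b) x.
  have [||u [v [-> h1 h2]]] := IH (x - L b); rewrite ?subr_ge0//.
    by rewrite ltrBlDl.
  by exists (b :: u), v; rewrite geo_len_cons; split=> //; lra.
exists [::], (b :: z); rewrite geo_len_nil add0r; split=> //.
exact: lt_le_trans xb (le_maxL L a0 b).
Qed.

(** The words are the images, at one fixed level m, of a word u with T - lam^m maxL < lam^m L(u) <=
    T. Their common geometric length is what later tells them apart inside a point. *)
Lemma language_packing (e : R) : 0 < e -> exists C : R, forall T, 0 <= T ->
  exists S : seq (seq A), [/\ uniq S, (0 < size S)%N,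
    forall w, w \in S -> in_language th w,
    exists2 l, l <= T & forall w, w \in S -> geo_len L w = l &
    T * (geo_entropy - e) - C <= ln (size S)%:R].
Proof.
move=> e0.
have [m _ /(_ m (leqnn m)) hm] : \forall n \near \oo, geo_entropy - e < min_rate n.
  by apply: (cvgr_gt geo_entropy min_rate_is_cvg); rewrite ltrBlDl ltrDr.
have lm : 0 < lam ^+ m by rewrite exprn_gt0.
exists (min_rate m * (lam ^+ m * maxL L a0)) => T T0.
have [k k0 kP] := long_iter_word (T / lam ^+ m) a0.
have [z za] := iter_word_nonempty th_neq0 k [:: a0].
have [|u [v [zE uT Tu]]] := geo_len_prefix _ (kP _ za).
  by rewrite divr_ge0 // ltW.
exists (undup (iter_word th m u)); split.
- exact: undup_uniq.
- exact: num_images_gt0.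
- move=> w; rewrite mem_undup => wu; have [q qv] := iter_word_nonempty th_neq0 m v.
  exists (m + k)%N, a0, (w ++ q); split; first exact: leq_trans (leq_addl _ _).
  split; last by apply/infixP; exists [::], q.
  apply/mem_iter_wordD; exists z => //; rewrite zE.
  by apply/mem_iter_word_cat; exists w, q.
- exists (lam ^+ m * geo_len L u).
    by rewrite mulrC -ler_pdivlMr.
  by move=> w; rewrite mem_undup => /geo_len_iter_word.
apply: le_trans (ln_num_images_ge m u).
rewrite lerBlDr -mulrDr -mulrDr.
apply: (@le_trans _ _ (T * min_rate m)); first by rewrite ler_wpM2l // ltW.
by rewrite mulrC ler_wpM2l ?min_rate_ge0 // mulrC -ler_pdivrMr // ltW.
Qed.

(** * The suspension flow *)

Implicit Types (x y : int -> A) (t : R).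

(** Birkhoff sum of the roof function: the time at which the orbit of (x, 0) enters the fibre over
    the [j]-th shift of [x]. *)
Definition psum x (j : nat) : R := \sum_(i < j) L (x i%:Z).

Lemma psumS x j : psum x j.+1 = psum x j + L (x j%:Z).
Proof. by rewrite /psum big_ord_recr. Qed.

Lemma psum0 x : psum x 0 = 0.
Proof. by rewrite /psum big_ord0. Qed.

Lemma psumD_ge x j k : psum x j + k%:R * minL L a0 <= psum x (j + k).
Proof.
elim: k => [|k IH]; first by rewrite addn0 mul0r addr0.
rewrite addnS psumS -natr1 mulrDl mul1r addrA lerD ?minL_le//.
Qed.

Lemma psum_le x j k : (j <= k)%N -> psum x j <= psum x k.
Proof.
move=> jk; rewrite -(subnKC jk); apply: le_trans (psumD_ge _ _ _).
by rewrite lerDl mulr_ge0 // ltW // minL_gt0.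
Qed.

Lemma psum_ge x j : j%:R * minL L a0 <= psum x j.
Proof. by have := psumD_ge x 0 j; rewrite psum0 !add0r. Qed.

Lemma eq_psum x y j : (forall i, (i < j)%N -> x i%:Z = y i%:Z) -> psum x j = psum y j.
Proof. by move=> xy; apply: eq_bigr => i _; rewrite xy. Qed.

Lemma tile_exists x t : exists j, t < psum x j.+1.
Proof.
exists (Num.truncn (t / minL L a0)); apply: lt_le_trans (psum_ge _ _).
by rewrite -ltr_pdivrMr ?minL_gt0 // truncnS_gt.
Qed.

Definition tile x t : nat := ex_minn (tile_exists x t).

Lemma tileP x t : 0 <= t -> psum x (tile x t) <= t < psum x (tile x t).+1.
Proof.
move=> t0; rewrite /tile; case: ex_minnP => j -> jmin; rewrite andbT.
case: j jmin => [|j] jmin; first by rewrite psum0.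
by rewrite leNgt; apply/negP => /jmin; rewrite ltnn.
Qed.

Lemma tile_eq x t j : psum x j <= t < psum x j.+1 -> tile x t = j.
Proof.
move=> /andP[jt tj]; rewrite /tile; case: ex_minnP => i ti imin.
apply/eqP; rewrite eqn_leq (imin _ tj) /= leqNgt; apply/negP => ij.
by have := le_lt_trans (le_trans (psum_le x ij) jt) ti; rewrite ltxx.
Qed.

Lemma tile_le x t s : t <= s -> (tile x t <= tile x s)%N.
Proof.
move=> ts; rewrite /tile; case: ex_minnP => i _ imin; case: ex_minnP => j sj _.
by apply: imin; apply: le_lt_trans sj.
Qed.

Lemma eq_tile x y t : 0 <= t ->
  (forall i, (i <= tile x t)%N -> x i%:Z = y i%:Z) -> tile y t = tile x t.
Proof.
move=> t0 xy; apply: tile_eq.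
rewrite -(@eq_psum x y) => [|i /ltnW/xy//].
by rewrite -(@eq_psum x y) ?tileP.
Qed.

Lemma iter_shift x k i : iter k (@Defs.shift A) x i = x (i + k%:Z).
Proof.
elim: k i => [|k IH] i; first by rewrite addr0.
by rewrite iterS /Defs.shift IH; congr x; lia.
Qed.

Lemma psum_iter_shift x k j :
  psum (iter k (@Defs.shift A) x) j = psum x (k + j) - psum x k.
Proof.
elim: j => [|j IH]; first by rewrite psum0 addn0 subrr.
rewrite addnS !psumS IH iter_shift [RHS]addrAC; congr (_ + L (x _)).
by lia.
Qed.

Lemma subshift_iter_shift x k : subshift th x -> subshift th (iter k (@Defs.shift A) x).
Proof.
move=> xX i n n0; rewrite (_ : window _ i n = window x (i + k%:Z) n); first exact: xX.
by apply: eq_map => j; rewrite iter_shift; congr x; lia.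
Qed.

(** For [t] non-negative, the explicit normal form of T_t(x, 0). *)
Definition flow_pt x t : (int -> A) * R :=
  (iter (tile x t) (@Defs.shift A) x, t - psum x (tile x t)).

Lemma hull_pts_flow_pt x t : subshift th x -> 0 <= t -> hull_pts th L (flow_pt x t).
Proof.
move=> xX t0; have /andP[h1 h2] := tileP x t0.
split; first exact: subshift_iter_shift.
rewrite /= subr_ge0 h1 iter_shift add0r; split=> //.
by rewrite ltrBlDl -psumS.
Qed.

Lemma flow_pt_id p : hull_pts th L p -> flow_pt p.1 p.2 = p.
Proof.
case: p => x s [_ /= [s0 sL]]; rewrite /flow_pt (@tile_eq _ _ 0) /=.
  by rewrite psum0 subr0.
by rewrite psumS psum0 add0r s0.
Qed.

(** [hull_flow] chooses by [epsilon], but the choice is forced: in a normal form the number of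
    shifts, added to [tile x t], must be [tile x (t + 1)]. *)
Lemma hull_flow_flow_pt x t : subshift th x -> 0 <= t ->
  hull_flow th L 1 (flow_pt x t) = flow_pt x (t + 1).
Proof.
move=> xX t0; have t10 : 0 <= t + 1 by rewrite addr_ge0.
rewrite /hull_flow; set P := (fun q => _).
have tl : (tile x t <= tile x (t + 1))%N by apply: tile_le; rewrite lerDl.
have E k : (iter k (@Defs.shift A) (flow_pt x t).1,
    (flow_pt x t).2 + 1 - \sum_(i < k) L ((flow_pt x t).1 i%:Z)) =
    (iter (tile x t + k) (@Defs.shift A) x, t + 1 - psum x (tile x t + k)).
  rewrite /flow_pt /= -iterD addnC -/(psum _ k) psum_iter_shift addnC.
  by congr pair; ring.
have [|Pq [k qE]] := @epsilon_spec _ (inhabits (flow_pt x t)) P.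
  exists (flow_pt x (t + 1)); split; first exact: hull_pts_flow_pt.
  by exists (tile x (t + 1) - tile x t)%N; rewrite E subnKC.
move: Pq; rewrite qE E => -[_ /= [h1 h2]].
rewrite /flow_pt (@tile_eq x (t + 1) (tile x t + k)) //.
rewrite iter_shift add0r in h2; rewrite psumS; apply/andP; split; lra.
Qed.

Lemma iter_hull_flow p k : hull_pts th L p ->
  iter k (hull_flow th L 1) p = flow_pt p.1 (p.2 + k%:R).
Proof.
move=> pY; have [pX [p0 _]] := pY.
elim: k => [|k IH]; first by rewrite addr0 flow_pt_id.
by rewrite iterS IH hull_flow_flow_pt ?addr_ge0 // -addrA natr1.
Qed.

(** * Compactness of the hull *)

Lemma hull_pts_q p : hull_dom th L p -> hull_pts th L (hull_q L p).
Proof.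
case: p => x s [/= xX [s0 sL]]; rewrite /hull_q /=; case: ltP => // _.
split; first exact: (@subshift_iter_shift x 1).
by split=> //=.
Qed.

Lemma hull_q_id p : hull_pts th L p -> hull_q L p = p.
Proof. by case=> _ [_ pL]; rewrite /hull_q pL. Qed.

Lemma hull_pts_dom p : hull_pts th L p -> hull_dom th L p.
Proof. by case=> pX [p0 /ltW pL]. Qed.

(** Along an ultrafilter every coordinate settles on one of finitely many letters and the heights
    converge in a compact segment, so no diagonal sequence is extracted. The closed domain
    [hull_dom] appears because limits of normal forms may reach the roof. *)
Lemma ultra_limit (U : set_system nat) (p : nat -> (int -> A) * R) :
  UltraFilter U -> (forall n, hull_dom th L (p n)) ->
  exists2 q, hull_dom th L q &
    forall N (e : R), 0 < e -> U [set n | near_pt N e q (p n)].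
Proof.
move=> UU pD.
have /boolp.choice[x xP] : forall i : int, exists c, U [set n | (p n).1 i = c].
  move=> i; apply: contrapT => /forallNP h.
  have : U [set n | forall c, (p n).1 i <> c].
    apply: filter_forall => c.
    by have [/h|] := in_ultra_setVsetC [set n | (p n).1 i = c] UU.
  by move=> /filter_ex[n /(_ _ erefl)].
have xN N : U [set n | forall i : int, `|i| <= N%:Z -> (p n).1 i = x i].
  have h : U [set n | forall j : 'I_(N + N).+1, (p n).1 (j%:Z - N%:Z) = x (j%:Z - N%:Z)].
    by apply: filter_forall => j; apply: xP.
  apply: filterS h => n h i iN.
  have jN : (`|(i + N%:Z)%R|%N < (N + N).+1)%N by lia.
  by have := h (Ordinal jN); rewrite /= (_ : _ - _ = i); [|lia].
have [s [s01 sU]] : exists s, `[0, maxL L a0]%classic s /\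
    forall e : R, 0 < e -> U [set n | `|(p n).2 - s| < e].
  have [|s [sI sc]] := @segment_compact R 0 (maxL L a0)
      ((fun n => (p n).2) @ U) _.
    rewrite /fmap /=; apply: filterS filterT => n _ /=.
    have [_ [h0 h1]] := pD n; rewrite in_itv /= h0 /=.
    exact: le_trans h1 (le_maxL _ _ _).
  exists s; split=> // e e0.
  have [//|h] := in_ultra_setVsetC [set n | `|(p n).2 - s| < e] UU.
  have [r [/= hr]] := sc [set r | ~ (`|r - s| < e)] _ h (nbhsx_ballx s e e0).
  by rewrite /ball /= distrC => /hr.
exists (x, s); last first.
  by move=> N e e0; apply: filterS2 (xN N) (sU e e0) => n h1 h2; split.
split=> /=.
  move=> i n n0; have [k kP] := filter_ex (xN (`|i| + n)%N).
  rewrite (_ : window x i n = window (p k).1 i n).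
    by have [pX _] := pD k; apply: pX.
  apply/eq_in_map => j; rewrite mem_iota add0n => /andP[_ jn].
  by rewrite kP //; lia.
move: s01; rewrite /= in_itv /= => /andP[-> _]; split=> //.
rewrite leNgt; apply/negP => Ls; rewrite -subr_gt0 in Ls.
have [n [h1 h2]] := filter_ex (filterI (xN 0%N) (sU _ Ls)).
have [_ [_]] := pD n; rewrite h1 // => h3.
by move: h2 h3; rewrite /= ltr_norml => /andP[? _]; lra.
Qed.

(** Otherwise some points p_N have neighbourhoods of scale N that fit into no member. A limit q of
    them lies in the preimage of a member under [hull_q]; this preimage is open at q, so it contains
    such a neighbourhood. *)
Lemma hull_lebesgue C : open_cover (hull_pts th L) (hull_open th L) C ->
  exists N : nat, forall p, hull_pts th L p -> exists2 B, C B &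
    forall q, hull_pts th L q -> near_pt N (N.+1%:R^-1) p q -> B q.
Proof.
move=> [Cop Ccov]; apply: contrapT => /forallNP h.
have /boolp.choice[p pP] : forall N : nat, exists p, hull_pts th L p /\
    forall B, C B -> exists q, [/\ hull_pts th L q, near_pt N (N.+1%:R^-1) p q & ~ B q].
  move=> N; apply: contrapT => /forallNP h'; apply: (h N) => p pY.
  apply: contrapT => nB; apply: (h' p); split=> // B CB.
  apply: contrapT => nq; apply: nB; exists B => // q qY pq.
  by apply: contrapT => nBq; apply: nq; exists q.
have [U [UU oU]] := ultraFilterLemma (eventually_filter : ProperFilter eventually).
have [|q qD qP] := ultra_limit (p := p) UU.
  by move=> n; apply: hull_pts_dom; case: (pP n).
have [B CB Bq] := Ccov _ (hull_pts_q qD).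
have [_ [_ /(_ q)[//|N0 [e [e0 NP]]]]] := Cop _ CB.
have e20 : 0 < e / 2 by rewrite divr_gt0.
(* From [K] on, the cylinders are at least as fine as [N0] and the radius is at most e / 2, which
   leaves e / 2 for the distance from [q] to [p n]. *)
pose K := maxn N0 (Num.truncn (2 / e)).
have UK : U [set n | (K <= n)%N] by apply: oU; exact: nbhs_infty_ge.
have [n [[q1 q2] Kn]] := filter_ex (filterI (qP N0 _ e20) UK).
have [_ /(_ _ CB)[r [rY [r1 r2] nBr]]] := pP n.
apply: nBr; have [] // : (hull_dom th L `&` hull_q L @^-1` B) r.
  apply: NP; first exact: hull_pts_dom.
  split.
    move=> i iN; rewrite r1; first exact: q1.
    apply: le_trans iN _; rewrite lez_nat.
    by move: Kn; rewrite /= geq_max => /andP[].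
  have : n.+1%:R^-1 <= e / 2.
    rewrite -[X in _ <= X]invrK lef_pV2 ?posrE ?invr_gt0// invf_div.
    apply: ltW; apply: lt_le_trans (truncnS_gt _) _; rewrite ler_nat ltnS.
    by move: Kn; rewrite /= geq_max => /andP[].
  move: r2 q2; rewrite !ltr_norml; move: (n.+1%:R^-1) => d /andP[? ?] /andP[? ?] ?.
  by apply/andP; split; lra.
by rewrite /= hull_q_id.
Qed.

(** * Upper bound *)

Lemma window_cat x i n n' :
  window x i (n + n') = window x i n ++ window x (i + n%:Z) n'.
Proof.
rewrite /window iotaD map_cat; congr (_ ++ _).
rewrite add0n -{1}[n]addn0 iotaDl -map_comp; apply: eq_map => k /=.
by congr x; lia.
Qed.

Lemma size_window x i n : size (window x i n) = n.
Proof. by rewrite size_map size_iota. Qed.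

Lemma eq_window x y i n : window x i n = window y i n ->
  forall k, (k < n)%N -> x (i + k%:Z) = y (i + k%:Z).
Proof.
move=> /eq_in_map h k kn; apply: h.
by rewrite mem_iota.
Qed.

Lemma geo_len_window x n : geo_len L (window x 0 n) = psum x n.
Proof.
elim: n => [|n IH]; first by rewrite psum0 geo_len_nil.
by rewrite -addn1 window_cat geo_len_cat IH addn1 psumS /= geo_len1 addr0 add0r.
Qed.

Section Codes.
Variables (N n : nat).

(** Bounds all times [p.2 + k] with [k <= n] at once, so that the code word depends on the base
    point alone. *)
Let horizon : R := n%:R + maxL L a0.

(** The letters at -N, ..., tile x horizon + N: everything within N of a tile visited up to the
    horizon. *)
Definition code_word x : seq A :=
  window x (- N%:Z) (N + (tile x horizon + N.+1)).

(* For a fixed word the tiles visited at times 0, ..., n are monotone in the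
   starting height, so their sum alone determines each of them. *)
Definition code (p : (int -> A) * R) : seq A * (nat * nat) :=
  (code_word p.1,
   ((\sum_(k < n.+1) tile p.1 (p.2 + k%:R))%N, Num.truncn (N.+1%:R * p.2))).

Let horizon_ge0 : 0 <= horizon.
Proof. by apply: addr_ge0 => //; apply/ltW/maxL_gt0. Qed.

Let before_horizon p k : hull_pts th L p -> (k <= n)%N ->
  0 <= p.2 + k%:R <= horizon.
Proof.
move=> [_ [p0 pL]] kn; rewrite addr_ge0 //= /horizon addrC lerD ?ler_nat//.
by apply: le_trans (ltW pL) (le_maxL _ _ _).
Qed.

Lemma geo_len_code_word x :
  geo_len L (code_word x) <= n%:R + N.+1.*2%:R * maxL L a0.
Proof.
rewrite /code_word !window_cat !geo_len_cat addNr geo_len_window.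
have := geo_len_le_maxL L a0 (window x (- N%:Z) N).
have := geo_len_le_maxL L a0 (window x (0 + (tile x horizon)%:Z) N.+1).
have /andP[+ _] := tileP x horizon_ge0.
rewrite !size_window /horizon -addnn natrD -natr1.
have := maxL_gt0 L_gt0 a0.
set m := maxL _ _; set a := geo_len _ _; set b := psum _ _; set c := geo_len _ _.
move: (N%:R : R) => r; nra.
Qed.

Lemma code_word_agree x y : code_word x = code_word y ->
  tile x horizon = tile y horizon /\
  forall i : int, - N%:Z <= i -> i <= (tile x horizon)%:Z + N%:Z -> x i = y i.
Proof.
move=> e; have := congr1 size e; rewrite !size_window => sE.
have tE : tile x horizon = tile y horizon by lia.
split=> // i i1 i2; move: e; rewrite /code_word -tE => /eq_window.
move=> /(_ `|(i + N%:Z)%R|%N); rewrite (_ : - N%:Z + _ = i); last by lia.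
by apply; lia.
Qed.

Lemma code_tile p q k : hull_pts th L p -> hull_pts th L q -> code p = code q ->
  (k <= n)%N -> tile p.1 (p.2 + k%:R) = tile q.1 (q.2 + k%:R).
Proof.
wlog pq : p q / p.2 <= q.2 => [IH pY qY pq kn|].
  have [h|/ltW h] := leP p.2 q.2; first exact: IH.
  by apply/esym; apply: IH.
move=> pY qY [/code_word_agree[_ xy] sE _].
have le j : (j <= n)%N -> (tile p.1 (p.2 + j%:R) <= tile q.1 (q.2 + j%:R))%N.
  move=> jn; have /andP[q0 qh] := before_horizon qY jn.
  rewrite (@eq_tile p.1 q.1) //; first by apply: tile_le; rewrite lerD2r.
  by move=> i ij; apply: xy; have := tile_le p.1 qh; lia.
move=> kn; apply/eqP; move: sE => /eqP.
have [_ ->] : (\sum_(k < n.+1) tile p.1 (p.2 + k%:R) <=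
    \sum_(k < n.+1) tile q.1 (q.2 + k%:R) ?= iff
    [forall k : 'I_n.+1, tile p.1 (p.2 + k%:R) == tile q.1 (q.2 + k%:R)])%N.
  apply: leqif_sum => i _; apply/leqif_eq/le; exact: (ltn_ord i).
by move=> /forallP/(_ (Ordinal (kn : (k < n.+1)%N))).
Qed.

Lemma code_near p q k : hull_pts th L p -> hull_pts th L q -> code p = code q ->
  (k <= n)%N ->
  near_pt N (N.+1%:R^-1) (flow_pt p.1 (p.2 + k%:R)) (flow_pt q.1 (q.2 + k%:R)).
Proof.
move=> pY qY pq kn; have tE := code_tile pY qY pq kn.
have /andP[p0 ph] := before_horizon pY kn.
have tl := tile_le p.1 ph.
move: pq => [/code_word_agree[_ xy] _ fE].
split.
  move=> i iN; rewrite /flow_pt /= !iter_shift -tE; apply/esym/xy; first by lia.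
  by move: tl; rewrite /horizon; lia.
rewrite /flow_pt /= -tE (@eq_psum q.1 p.1); last first.
  by move=> i ij; apply/esym/xy; move: tl; lia.
have [_ [q0 _]] := qY; have [_ [{}p0 _]] := pY.
(* Equal integer parts of (N + 1) times the starting heights put these within 1 / (N + 1); equal
   tiles carry this over to time [k]. *)
have NR : 0 < N.+1%:R :> R by [].
have := @truncn_itv R (N.+1%:R * p.2) (mulr_ge0 (ltW NR) p0).
have := @truncn_itv R (N.+1%:R * q.2) (mulr_ge0 (ltW NR) q0).
rewrite -fE -[(Num.truncn _).+1%:R]natr1; set f := (Num.truncn _)%:R.
move=> /andP[q1 q2] /andP[p1 p2].
rewrite -(ltr_pM2l NR) divff ?gt_eqF //.
have -> : q.2 + k%:R - psum p.1 (tile p.1 (p.2 + k%:R)) -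
  (p.2 + k%:R - psum p.1 (tile p.1 (p.2 + k%:R))) = q.2 - p.2 by ring.
rewrite -[X in X * `|_|]gtr0_norm // -normrM mulrBr ltr_norml.
by apply/andP; split; lra.
Qed.

(** Tile indices up to the horizon are at most linear in [n], so the sum of n + 1 of them is at most
    quadratic: each word has only polynomially many codes. *)
Lemma code_bounds p c d : hull_pts th L p ->
  (1 + maxL L a0) / minL L a0 < c%:R -> N.+1%:R * maxL L a0 < d%:R ->
  ((code p).2.1 < n.+1 * (n.+1 * c))%N /\ ((code p).2.2 < d)%N.
Proof.
move=> pY hc hd; have [_ [p0 pL]] := pY; split; last first.
  rewrite /= truncn_lt_nat ?mulr_ge0//; apply: le_lt_trans hd.
  by rewrite ler_wpM2l // (le_trans (ltW pL) (le_maxL _ _ _)).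
have hK : (tile p.1 horizon < n.+1 * c)%N.
  rewrite -(ltr_nat R) natrM -(ltr_pM2r (minL_gt0 L_gt0 a0)).
  apply: le_lt_trans (psum_ge p.1 _) _.
  have /andP[+ _] := tileP p.1 horizon_ge0; move=> /le_lt_trans; apply.
  rewrite -mulrA; move: hc; rewrite ltr_pdivrMr ?minL_gt0 // => hc.
  apply: le_lt_trans (_ : _ <= n.+1%:R * (1 + maxL L a0)) _; last by rewrite ltr_pM2l.
  rewrite /horizon -natr1; have := maxL_gt0 L_gt0 a0.
  by have : 0 <= n%:R :> R by []; move: (n%:R : R) => r; nra.
apply: (@leq_ltn_trans (n.+1 * tile p.1 horizon)); last by rewrite ltn_pmul2l.
rewrite -[X in (_ <= X * _)%N]card_ord -sum_nat_const /=; apply: leq_sum => i _.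
by apply: tile_le; have /andP[] := before_horizon pY (ltn_ord i : (i <= n)%N).
Qed.

End Codes.

(** One point [p] of each code class is followed, with a Lebesgue member [g k] around its position
    at each time; by [code_near] these members also contain the orbits of the rest of the class. A
    code that does not occur gets the empty set. *)
Lemma hull_cover_by_codes C N n :
  (forall p, hull_pts th L p -> exists2 B, C B &
    forall q, hull_pts th L q -> near_pt N (N.+1%:R^-1) p q -> B q) ->
  forall c, exists B, (exists2 p, hull_pts th L p & code N n p = c) ->
    cover_join (hull_flow th L 1) C n.+1 B /\
    forall q, hull_pts th L q -> code N n q = c -> B q.
Proof.
move=> NP c; have [[p pY pc]|np] := pselect (exists2 p, hull_pts th L p & code N n p = c);
  last by exists set0 => /np.
have pk0 q (k : nat) : hull_pts th L q -> 0 <= q.2 + k%:R.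
  by move=> [_ [q0 _]]; apply: addr_ge0.
have /boolp.choice[g gP] : forall k : nat, exists B, C B /\ forall q, hull_pts th L q ->
    near_pt N (N.+1%:R^-1) (flow_pt p.1 (p.2 + k%:R)) q -> B q.
  move=> k; have [|B CB BP] := NP (flow_pt p.1 (p.2 + k%:R)); last by exists B.
  by apply: hull_pts_flow_pt; [case: pY|exact: pk0].
exists (\bigcap_(k in [set k : nat | (k < n.+1)%N])
  (iter k (hull_flow th L 1) @^-1` g k)) => _; split.
  by exists g; split=> // k _; case: (gP k).
move=> q qY qc k /= kn; rewrite iter_hull_flow //; have [_] := gP k; apply.
  by apply: hull_pts_flow_pt; [case: qY|exact: pk0].
by apply: (@code_near N n) => //; rewrite pc.
Qed.

(** Absorbs the quadratic factor of [code_bounds] into an exponential of arbitrarily small rate. *)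
Lemma square_le_expR (d x : R) : 0 < d -> 0 <= x -> x * x <= d ^- 2 * expR (2 * d * x).
Proof.
move=> d0 x0; rewrite [X in _ <= X]mulrC ler_pdivlMr ?exprn_gt0//.
rewrite (_ : _ * d ^+ 2 = (d * x) ^+ 2); last by ring.
rewrite (_ : 2 * d * x = d * x + d * x); last by ring.
rewrite expRD -expr2 lerXn2r ?nnegrE ?mulr_ge0 ?expR_ge0 ?(ltW d0)//.
by apply: le_trans (expR_ge1Dx _); rewrite lerDr.
Qed.

Lemma hull_cover_upper C (e : R) : open_cover (hull_pts th L) (hull_open th L) C ->
  0 < e -> exists D : R, forall n, exists s : seq (set ((int -> A) * R)), [/\
    forall B, B \in s -> cover_join (hull_flow th L 1) C n.+1 B,
    hull_pts th L `<=` (fun p => exists2 B, B \in s & B p) &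
    (size s)%:R <= expR (n%:R * (geo_entropy + e) + D)].
Proof.
move=> CP e0; have [N NP] := hull_lebesgue CP.
(* Half of [e] goes to the language count, the other half, as 2 (e / 4), to the factor (n + 1)^2. *)
have e20 : 0 < e / 2 by rewrite divr_gt0.
have e40 : 0 < e / 4 by rewrite divr_gt0.
have [C0 C0P] := language_count e20.
have exc (x : R) : exists2 c : nat, x < c%:R & 0 < c%:R :> R.
  by exists (Num.truncn x).+1; rewrite ?truncnS_gt ?ltr0Sn.
have [c1 c1P c10] := exc ((1 + maxL L a0) / minL L a0).
have [d dP d0] := exc (N.+1%:R * maxL L a0).
pose T0 := N.+1.*2%:R * maxL L a0.
have T00 : 0 <= T0 by rewrite mulr_ge0 // ltW // maxL_gt0.
exists (T0 * (geo_entropy + e / 2) + C0 + e / 2 + ln ((e / 4) ^- 2)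
  + ln c1%:R + ln d%:R) => n.
have [S SP Ss] := C0P (n%:R + T0) (addr_ge0 (ler0n _ n) T00).
have /boolp.choice[B BP] := hull_cover_by_codes n NP.
pose codes := [seq (w, ij) | w <- S,
  ij <- [seq (i, j) | i <- iota 0 (n.+1 * (n.+1 * c1)), j <- iota 0 d]].
pose good c := exists2 p, hull_pts th L p & code N n p = c.
exists [seq B c | c <- codes & `[<good c>]]; split.
- move=> G /mapP[c]; rewrite mem_filter => /andP[/asboolP gc' _] ->.
  by have [] := BP c gc'.
- move=> p pY; exists (B (code N n p)); last first.
    by have [|_ h] := BP (code N n p); [exists p|exact: h].
  apply: map_f; rewrite mem_filter; apply/andP; split; first by apply/asboolP; exists p.
  have [h1 h2] := code_bounds n pY c1P dP.
  apply/allpairsP; exists ((code N n p).1, (code N n p).2); split=> //.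
    apply: SP; last exact: geo_len_code_word.
    by have [pX _] := pY; rewrite /= /code_word; apply: pX; rewrite !addnS.
  apply/allpairsP; exists ((code N n p).2.1, (code N n p).2.2).
  by rewrite !mem_iota.
rewrite size_map; apply: (@le_trans _ _ (size codes)%:R).
  by rewrite ler_nat size_filter count_size.
rewrite !size_allpairs !size_iota !natrM.
have h2 := square_le_expR e40 (ler0n R n.+1).
have i0 : 0 < (e / 4) ^- 2 by rewrite invr_gt0 exprn_gt0.
apply: (@le_trans _ _ (expR ((n%:R + T0) * (geo_entropy + e / 2) + C0) *
  (((e / 4) ^- 2 * expR (2 * (e / 4) * n.+1%:R)) * c1%:R * d%:R))).
  apply: ler_pM => //.
  by rewrite mulrA !ler_wpM2r // ltW.
rewrite -[X in _ * (X * _ * _ * _)]lnK ?posrE// -[X in _ * (_ * X * _)]lnK ?posrE//.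
rewrite -[X in _ * (_ * _ * X)]lnK ?posrE// -!expRD ler_expR.
by rewrite -[n.+1%:R]natr1; move: (ln _) => l; lra.
Qed.

(** * Lower bound *)

Section SeparatingCover.
Variable N : nat.

Definition inner_set x : set ((int -> A) * R) :=
  [set p | hull_pts th L p /\ 0 < p.2 /\
    forall i : nat, (i <= N)%N -> p.1 i%:Z = x i%:Z].

(** Points near height 0: in the lower half of a fibre, or in the upper half of the preceding fibre,
    where the letters are read one place later. The second clause makes the set open across the
    identification. *)
Definition near_edge x (p : (int -> A) * R) :=
  (p.2 < L (p.1 0) / 2 /\ forall i : nat, (i <= N)%N -> p.1 i%:Z = x i%:Z) \/
  (L (p.1 0) / 2 < p.2 /\ forall i : nat, (i <= N)%N -> p.1 (i%:Z + 1) = x i%:Z).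

Definition edge_set x : set ((int -> A) * R) :=
  [set p | hull_pts th L p /\ near_edge x p].

(* The points at height 0 are only covered by sets [edge_set x], which reveal the
   letters 0, ..., N; from then on two points with a common past sit at equal
   heights, so every member containing both reveals the next N letters. *)
Definition sep_cover : set (set ((int -> A) * R)) :=
  [set B | exists x, B = inner_set x \/ B = edge_set x].

Lemma edge_set_hull_q x p :
  hull_dom th L p -> edge_set x (hull_q L p) <-> near_edge x p.
Proof.
move=> pD; suff h : near_edge x (hull_q L p) <-> near_edge x p.
  by split=> [[_ /h]//|/h]; split=> //; exact: hull_pts_q.
rewrite /hull_q; case: ltP => // Lp; rewrite /near_edge /= /Defs.shift.
have L0 := L_gt0 (p.1 0); have L1 := L_gt0 (p.1 (0 + 1)).
split=> [] [[h1 h2]|[h1 h2]].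
- by right; split=> //; lra.
- by exfalso; lra.
- by exfalso; lra.
- by left; split=> //; lra.
Qed.

Lemma near_edge_open x p : near_edge x p ->
  exists2 e : R, 0 < e & forall q, near_pt N.+1 e p q -> near_edge x q.
Proof.
case=> -[h1 h2].
  exists (L (p.1 0) / 2 - p.2); first by rewrite subr_gt0.
  move=> q [q1 q2]; left; rewrite q1 //; split.
    by move: q2; rewrite ltr_norml => /andP[_ ?]; lra.
  by move=> i iN; rewrite q1 ?h2 //; lia.
exists (p.2 - L (p.1 0) / 2); first by rewrite subr_gt0.
move=> q [q1 q2]; right; rewrite q1 //; split.
  by move: q2; rewrite ltr_norml => /andP[? _]; lra.
by move=> i iN; rewrite q1 ?h2 //; lia.
Qed.

Lemma sep_cover_open : open_cover (hull_pts th L) (hull_open th L) sep_cover.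
Proof.
split; last first.
  move=> [x s] pY; have [_ [/= s0 sL]] := pY.
  have [s00|s00] := eqVneq s 0.
    exists (edge_set x); first by exists x; right.
    by split=> //; left=> /=; rewrite s00 divr_gt0.
  exists (inner_set x); first by exists x; left.
  by split=> //=; rewrite lt_neqAle eq_sym s00 s0.
move=> _ [x [->|->]]; split; try by move=> p [].
  split=> [p []//|p [pD [/= qY [q0 qx]]]].
  have pL : p.2 < L (p.1 0).
    by move: q0; rewrite /hull_q; case: (ltP p.2 _) => // _; rewrite /= ltxx.
  rewrite /hull_q pL in q0 qx.
  exists N, (Num.min p.2 (L (p.1 0) - p.2)).
  split; first by rewrite lt_min q0 subr_gt0.
  move=> q qD [q1]; rewrite lt_min !ltr_norml => /andP[/andP[h1 h2] /andP[h3 h4]].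
  have {}qY : hull_pts th L q.
    by have [qX [q20 _]] := qD; split=> //; split=> //; rewrite q1 //; lra.
  split=> //=; rewrite hull_q_id //; split=> //; split; first by lra.
  by move=> i iN; rewrite q1 ?qx //; lia.
split=> [p []//|p [pD /= /(edge_set_hull_q x pD)/near_edge_open[e e0 eP]]].
exists N.+1, e; split=> // q qD /eP qE; split=> //=.
exact/edge_set_hull_q.
Qed.

(** Equal letters up to the current tile give equal heights and equal fibre lengths, so in an edge
    set both points lie in the same half of the fibre and satisfy the same clause of [near_edge]. *)
Lemma sep_cover_step B x y t : sep_cover B -> 0 <= t ->
  (forall i, (i <= tile x t)%N -> x i%:Z = y i%:Z) ->
  B (flow_pt x t) -> B (flow_pt y t) ->
  forall i, (i <= tile x t + N)%N -> x i%:Z = y i%:Z.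
Proof.
move=> BC t0 xy Bx By i ij; have [/xy//|tx] := leqP i (tile x t).
have tE := eq_tile t0 xy.
have sE : (flow_pt y t).2 = (flow_pt x t).2.
  by rewrite /flow_pt /= tE (@eq_psum y x) // => k /ltnW/xy.
have pE (k : nat) : (flow_pt x t).1 k%:Z = x (tile x t + k)%N%:Z.
  by rewrite /flow_pt /= iter_shift; congr x; lia.
have qE (k : nat) : (flow_pt y t).1 k%:Z = y (tile x t + k)%N%:Z.
  by rewrite /flow_pt /= tE iter_shift; congr y; lia.
have LE : L ((flow_pt y t).1 0) = L ((flow_pt x t).1 0).
  by rewrite (pE 0%N) (qE 0%N) addn0 xy.
move: BC => [z [BE|BE]]; rewrite BE in Bx By.
  have [_ [_ /(_ (i - tile x t)%N)]] := Bx; have [_ [_ /(_ (i - tile x t)%N)]] := By.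
  by rewrite pE qE subnKC ?(ltnW tx) // => <- //; [move=> ->//|]; lia.
have [_] := Bx; have [_] := By; rewrite /near_edge sE LE.
(* The letter at [i] has index j + 1 in the first clause of [near_edge] and index j in the
   second. *)
have [j iE jN] : exists2 j, i = (tile x t + j.+1)%N & (j < N)%N.
  by exists (i - tile x t).-1; lia.
move=> [[h1 h2]|[h1 h2]] [[h3 h4]|[h3 h4]]; try by exfalso; lra.
  by rewrite iE -pE -qE h2 ?h4.
rewrite iE -pE -qE; have := h2 j (ltnW jN); have := h4 j (ltnW jN).
by rewrite (_ : j%:Z + 1 = j.+1%:Z); [move=> -> ->|lia].
Qed.

Lemma sep_cover_base B x y : sep_cover B -> B (x, 0) -> B (y, 0) ->
  forall i, (i <= N)%N -> x i%:Z = y i%:Z.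
Proof.
move=> [z [->|->]]; first by case=> _ [/=]; rewrite ltxx.
move=> [_ [[_ hx]|[/= h _]]]; last by have := L_gt0 (x 0); lra.
move=> [_ [[_ hy]|[/= h _]]]; last by have := L_gt0 (y 0); lra.
by move=> i iN; have /= -> := hx i iN; have /= -> := hy i iN.
Qed.

Hypothesis N_large : 1 <= N%:R * minL L a0.

(** [N] tiles last at least one unit of time, so the letters read at time [t] cover the tile reached
    at time [t + 1]; this keeps the induction of [cover_join_sep] going. *)
Lemma tile_step x t : 0 <= t -> (tile x (t + 1) <= tile x t + N)%N.
Proof.
move=> t0; rewrite leqNgt; apply/negP => h.
have /andP[_ t1] := tileP x t0.
have /andP[t2 _] := tileP x (addr_ge0 t0 ler01).
have h1 : psum x ((tile x t).+1 + N) <= psum x (tile x (t + 1)).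
  by apply: psum_le; rewrite addSn.
have := lt_le_trans (ltr_leD t1 N_large) (psumD_ge x (tile x t).+1 N).
by move=> /lt_le_trans/(_ (le_trans h1 t2)); rewrite ltxx.
Qed.

Lemma hull_pts0 x : subshift th x -> hull_pts th L (x, 0).
Proof. by split=> //=. Qed.

Lemma cover_join_sep B x y n : subshift th x -> subshift th y ->
  cover_join (hull_flow th L 1) sep_cover n.+1 B -> B (x, 0) -> B (y, 0) ->
  forall k, (k <= n)%N -> forall i, (i <= tile x k%:R + N)%N -> x i%:Z = y i%:Z.
Proof.
move=> xX yX [g [gC ->]] gx gy; elim=> [|k IH] kn i.
  rewrite (@tile_eq x 0 0); last by rewrite psumS psum0 lexx add0r L_gt0.
  rewrite add0n => iN; apply: (sep_cover_base (gC 0%N isT)) iN.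
  - exact: (gx 0%N).
  - exact: (gy 0%N).
have k0 : 0 <= k%:R :> R by [].
apply: (sep_cover_step (gC k.+1 kn)) => //.
- move=> j jk; apply: IH; first exact: ltnW.
  by apply: leq_trans jk _; rewrite -natr1; exact: tile_step.
- by have := gx k.+1 kn; rewrite /= -iterS iter_hull_flow ?add0r //; exact: hull_pts0.
- by have := gy k.+1 kn; rewrite /= -iterS iter_hull_flow ?add0r //; exact: hull_pts0.
Qed.

(** By time [n] both words have been read completely, since their length is at most [n]. They are
    then prefixes of one word with equal geometric lengths. *)
Lemma sep_cover_words B x y v w n :
  subshift th x -> subshift th y ->
  window x 0 (size v) = v -> window y 0 (size w) = w ->
  geo_len L v = geo_len L w -> geo_len L v <= n%:R ->
  cover_join (hull_flow th L 1) sep_cover n.+1 B -> B (x, 0) -> B (y, 0) -> v = w.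
Proof.
move=> xX yX xv yw vw vn BJ Bx By.
have xy := cover_join_sep xX yX BJ Bx By (leqnn n).
have n0 : 0 <= n%:R :> R by [].
have tE : tile y n%:R = tile x n%:R.
  by apply: eq_tile => // i ij; apply: xy; exact: leq_trans ij (leq_addr _ _).
have short z u : window z 0 (size u) = u -> geo_len L u <= n%:R ->
    exists r, window z 0 (tile z n%:R) = u ++ r.
  move=> zu un; have st : (size u <= tile z n%:R)%N.
    rewrite leqNgt; apply/negP => /(psum_le z).
    have /andP[_] := tileP z n0; move=> /lt_le_trans h /h.
    by rewrite -geo_len_window zu; lra.
  exists (window z (0 + (size u)%:Z) (tile z n%:R - size u)).
  by rewrite -[X in _ = X ++ _]zu -window_cat subnKC.
have [r rE] := short x v xv vn; have [|s sE] := short y w yw; first by rewrite -vw.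
have E : window x 0 (tile x n%:R) = window y 0 (tile y n%:R).
  rewrite tE; apply/eq_in_map => i; rewrite mem_iota add0n => /andP[_ ij].
  by rewrite add0r; apply: xy; apply: leq_trans (ltnW ij) (leq_addr _ _).
by rewrite rE sE in E; have [] := cat_geo_len_inj L_gt0 vw E.
Qed.

(** Each word of a packing is placed at height 0 of a point; by [sep_cover_words] a member of the
    subcover cannot contain the points of two different words. *)
Lemma sep_cover_lower (e : R) : 0 < e -> exists D : R,
  forall n (s : seq (set ((int -> A) * R))),
    (forall B, B \in s -> cover_join (hull_flow th L 1) sep_cover n.+1 B) ->
    hull_pts th L `<=` (fun p => exists2 B, B \in s & B p) ->
    (0 < size s)%N /\ n%:R * (geo_entropy - e) - D <= ln (size s)%:R.
Proof.
move=> e0; have [D DP] := language_packing e0; exists D => n s sJ sY.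
have [S [Su S0 Sl [l ln Sn] SD]] := DP n%:R (ler0n _ _).
have /boolp.choice[X XP] : forall w, exists x, w \in S ->
    subshift th x /\ window x 0 (size w) = w.
  move=> w; case: (boolP (w \in S)) => [wS|_]; last by exists (fun=> a0).
  by have [x ? ?] := in_language_window (Sl w wS); exists x.
have /boolp.choice[G GP] : forall w, exists B, w \in S -> B \in s /\ B (X w, 0).
  move=> w; case: (boolP (w \in S)) => [wS|_]; last by exists set0.
  have [xX _] := XP w wS; have [B Bs Bx] := sY _ (hull_pts0 xX).
  by exists B.
have le : (size S <= size s)%N.
  rewrite -(size_map G); apply: uniq_leq_size; last first.
    by move=> B /mapP[w wS ->]; have [] := GP w wS.
  rewrite map_inj_in_uniq // => v w vS wS vw.
  have [Xv vE] := XP v vS; have [Xw wE] := XP w wS.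
  have [Gs Gv] := GP v vS; have [_ Gw] := GP w wS.
  apply: (sep_cover_words (B := G v) (n := n) Xv Xw vE wE) => //.
  - by rewrite !Sn.
  - by rewrite Sn.
  - exact: sJ.
  - by rewrite vw.
have s0 := leq_trans S0 le; split=> //; apply: le_trans SD _.
by rewrite ler_ln ?posrE ?ltr0n ?ler_nat.
Qed.

End SeparatingCover.

(** * Entropy *)

Definition subcover (T : Type) (Y : set T) (F : set (set T)) (s : seq (set T)) :=
  (forall B, B \in s -> F B) /\ Y `<=` (fun p => exists2 B, B \in s & B p).

Lemma ln_cover_num_le (T : Type) (Y : set T) F s (z : R) :
  subcover Y F s -> 0 <= z -> (size s)%:R <= expR z -> ln (cover_num R Y F) <= z.
Proof.
(* [ln] is 0 at non-positive arguments, so this case rests on [0 <= z]. *)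
move=> sF z0 sz; have [c0|c0] := leP (cover_num R Y F) 0; first by rewrite ln0.
rewrite -[z]expRK ler_ln ?posrE ?expR_gt0//; apply: le_trans sz.
apply: ge_inf; last by exists s.
by exists 0 => _ [s' _ <-].
Qed.

(** The subcover [s] ensures that the infimum runs over a non-empty set; positivity of the sizes
    excludes the convention [ln 0 = 0]. *)
Lemma ln_cover_num_ge (T : Type) (Y : set T) F s (z : R) :
  subcover Y F s ->
  (forall s', subcover Y F s' -> (0 < size s')%N /\ z <= ln (size s')%:R) ->
  z <= ln (cover_num R Y F).
Proof.
move=> sF h; have zc : expR z <= cover_num R Y F.
  apply: lb_le_inf; first by exists (size s)%:R, s.
  move=> _ [s' /h[s0 zs] <-].
  by rewrite -[X in _ <= X]lnK ?posrE ?ltr0n // ler_expR.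
by rewrite -[z]expRK ler_ln ?posrE ?expR_gt0 // (lt_le_trans (expR_gt0 _) zc).
Qed.

Let cover_rate C n : R :=
  ln (cover_num R (hull_pts th L) (cover_join (hull_flow th L 1) C n.+1)) / n.+1%:R.

Lemma cover_rate_le C (e : R) : open_cover (hull_pts th L) (hull_open th L) C ->
  0 < e -> \forall n \near \oo, cover_rate C n <= geo_entropy + e.
Proof.
move=> CP e0; have e20 : 0 < e / 2 by rewrite divr_gt0.
have [D DP] := hull_cover_upper CP e20; pose D' := Num.max D 0.
near=> n; have [s [s1 s2 sz]] := DP n.
have hD : D <= D' by rewrite le_max lexx.
have D0 : 0 <= D' by rewrite le_max lexx orbT.
have n0 : 0 <= n%:R :> R by [].
have z0 : 0 <= n%:R * (geo_entropy + e / 2) + D'.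
  by rewrite addr_ge0 // mulr_ge0 // addr_ge0 ?geo_entropy_ge0 // ltW.
rewrite ler_pdivrMr //; apply: le_trans (ln_cover_num_le (s := s) _ z0 _) _.
- by split.
- by apply: le_trans sz _; rewrite ler_expR lerD2l.
have : D' <= n%:R * (e / 2).
  rewrite -ler_pdivrMr // ltW //; apply: lt_le_trans (truncnS_gt _) _.
  by rewrite ler_nat; near: n; exact: nbhs_infty_ge.
by rewrite -[n.+1%:R]natr1; have := geo_entropy_ge0; nra.
Unshelve. all: by end_near. Qed.

Lemma cover_rate_ge N (e : R) : 1 <= N%:R * minL L a0 -> 0 < e ->
  \forall n \near \oo, geo_entropy - e <= cover_rate (sep_cover N) n.
Proof.
move=> NL e0; have e20 : 0 < e / 2 by rewrite divr_gt0.
have [D DP] := sep_cover_lower NL e20.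
have [D' DP'] := hull_cover_upper (sep_cover_open N) e0.
near=> n; have [s [s1 s2 _]] := DP' n.
rewrite ler_pdivlMr //.
apply: (@le_trans _ _ (n%:R * (geo_entropy - e / 2) - D)); last first.
  apply: (ln_cover_num_ge (s := s)); first by split.
  by move=> s' [h1 h2]; apply: DP.
have : D + geo_entropy <= n%:R * (e / 2).
  rewrite -ler_pdivrMr // ltW //; apply: lt_le_trans (truncnS_gt _) _.
  by rewrite ler_nat; near: n; exact: nbhs_infty_ge.
by rewrite -[n.+1%:R]natr1; have : 0 <= n%:R :> R by []; nra.
Unshelve. all: by end_near. Qed.

Lemma entropy_cover_le C : open_cover (hull_pts th L) (hull_open th L) C ->
  entropy_cover R (hull_pts th L) (hull_flow th L 1) C <= geo_entropy.
Proof.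
move=> CP; rewrite /entropy_cover; set v := (fun n => _).
(* [limn] of a divergent sequence is the default point, here 0. *)
have [cv|ncv] := pselect (cvgn v); last by rewrite (dvgP ncv) geo_entropy_ge0.
apply/ler_addgt0Pr => e e0; apply: limr_le => //; exact: cover_rate_le.
Qed.

Lemma entropy_sep_cover N : 1 <= N%:R * minL L a0 ->
  entropy_cover R (hull_pts th L) (hull_flow th L 1) (sep_cover N) = geo_entropy.
Proof.
move=> NL; apply/cvg_lim => //; apply/cvgrPdist_le => e e0; near=> n.
rewrite distrC ler_distl; apply/andP; split.
  by near: n; exact: cover_rate_ge.
by near: n; apply: cover_rate_le e0; exact: sep_cover_open.
Unshelve. all: by end_near. Qed.

(** The supremum is attained by a single cover, [sep_cover N] with N minL at least 1. *)
Lemma hull_entropyE : hull_entropy th L = geo_entropy%:E.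
Proof.
apply/le_anti/andP; split.
  by apply: ub_ereal_sup => _ [C CP <-]; rewrite lee_fin entropy_cover_le.
have [N NL] : exists N : nat, 1 <= N%:R * minL L a0.
  exists (Num.truncn (minL L a0)^-1).+1.
  by rewrite -ler_pdivrMr ?minL_gt0 // mul1r ltW // truncnS_gt.
apply: ereal_sup_ubound; exists (sep_cover N); first exact: sep_cover_open.
by rewrite entropy_sep_cover.
Qed.

End CompatibleSubstitution.

Theorem theoremA (R : realType) (A : finType) (th : A -> seq (seq A))
  (lam : R) (L : A -> R) :
  (forall a, th a != [::]) ->
  (forall a w, w \in th a -> w != [::]) ->
  primitive_rs th ->
  geom_compat_data th lam L ->
  forall a : A, exists h : R,
    (fun m : nat => ln ((card_subst_iter th m a)%:R) / (lam ^+ m * L a))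
       @ \oo --> h /\
    h%:E = hull_entropy th L.
Proof.
(* The letter [a] itself serves as base letter, and the stated quotient is convertible to
   [image_rate]. *)
move=> th_neq0 _ prim gc a; exists (geo_entropy th lam L a); split.
  exact: (image_rate_cvg th_neq0 gc prim).
by rewrite (hull_entropyE th_neq0 gc a prim).
Qed.
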